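(* Suppose that $U$ is a connected open subset of $\mathbb{C}$ with $U \neq \mathbb{C}$. If $U$ is holomorphically simply connected, then $U$ is biholomorphic to the unit disc, i.e., there is a one-to-one holomorphic function from $U$ onto the unit disc $D = \{z \in \mathbb{C} : |z| < 1\}$.
   Context: A connected open set $U \subseteq \mathbb{C}$ is called holomorphically simply connected if every holomorphic function on $U$ has a holomorphic antiderivative on $U$: for every holomorphic $f : U \to \mathbb{C}$ there is a holomorphic $F : U \to \mathbb{C}$ with $F' = f$ on $U$. Connected sets are understood to be nonempty. *)

(* Defs.v *)
From Stdlib Require Import Reals.
From Coquelicot Require Import Coquelicot.
Open Scope R_scope.

(* The pieces of a separation of [A] in the subspace topology are the traces
   on [A] of open sets [V] and [W] of [T]; connected sets are nonempty. *)
Definition connected {T : UniformSpace} (A : T -> Prop) : Prop :=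
  (exists x, A x) /\
  forall V W : T -> Prop, open V -> open W ->
    (forall x, A x -> V x \/ W x) ->
    (exists x, A x /\ V x) -> (exists x, A x /\ W x) ->
    exists x, A x /\ V x /\ W x.

(* Functions on [U] are total functions [C -> C] whose values off [U] are
   irrelevant: for open [U], differentiability at a point of [U] depends only
   on the values in [U]. *)
Definition holomorphic_on (U : C -> Prop) (f : C -> C) : Prop :=
  forall z : C, U z -> ex_derive (K := C_AbsRing) (V := C_NormedModule) f z.

Definition holomorphically_simply_connected (U : C -> Prop) : Prop :=
  forall f : C -> C, holomorphic_on U f ->
    exists F : C -> C, holomorphic_on U F /\
      forall z : C, U z ->
        is_derive (K := C_AbsRing) (V := C_NormedModule) F z (f z).

Definition unit_disc (z : C) : Prop := Cmod z < 1.

(* Main.v *)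
Require Import Defs.
From Stdlib Require Import Reals Lra Lia Classical ClassicalEpsilon.
From Coquelicot Require Import Coquelicot.
From mathcomp Require filter.
Open Scope R_scope.

(** The map is the one maximizing [|f'(a)|] among injective holomorphic [f : U -> D] with [f a = 0].
    Such maps exist: a branch of [sqrt (z - c)], [c] outside [U], is injective and misses a
    neighbourhood of [- sqrt (a - c)].  If a competitor misses [w] in [D], composing it with a
    Moebius map sending [w] to [0], a square root, and another Moebius map increases [|f'(a)|].

    The extremal map is the pointwise limit of a maximizing sequence along an ultrafilter on
    [nat]; the Cauchy estimates make the first-order Taylor remainders uniformly quadratic, so
    the limit is holomorphic and its derivative is the limit of the derivatives.  Its injectivity
    is Hurwitz's theorem, obtained as follows.  If [h] has no zero in a disc of radius [r] and
    [|h| <= 1], then a root [h^(1/m)] is bounded by [1], hence varies by at most [1/2] on the disc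
    of radius [r/4]; so [|h| <= 4^-m] at the centre implies [|h| <= (3/4)^m] nearby, and a limit
    of such functions vanishing at the centre vanishes near it.

    Goursat's lemma is not needed: a holomorphic function on [U] is the derivative of its
    antiderivative, which is therefore of class [C^1], and for [C^1] functions the Cauchy formula
    for the derivative follows by differentiation under the integral sign. *)

(** * Complex derivatives, curves and the exponential *)

(** Two uniform structures on C are in use: the balls of [CU] are discs for [Cmod], those of
    [C_UniformSpace] come from R x R. Their neighbourhoods agree by [locally_C], and [cont_CU]
    passes from one to the other. *)
Notation CU := (AbsRing_UniformSpace C_AbsRing).
Notation Cder := (@is_derive C_AbsRing C_NormedModule).
Notation Rder := (@is_derive R_AbsRing C_R_NormedModule).
Notation CInt := (@RInt C_R_CompleteNormedModule).
Notation is_CInt := (@is_RInt C_R_NormedModule).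

Lemma is_derive_eps (K : AbsRing) (V : NormedModule K) (f : K -> V) (x : K) (l : V) :
  is_derive f x l <->
  forall eps : R, 0 < eps -> exists delta : R, 0 < delta /\ forall y : K,
    abs (minus y x) < delta ->
    norm (minus (minus (f y) (f x)) (scal (minus y x) l)) <= eps * abs (minus y x).
Proof.
split.
- intros [_ H] eps Heps.
  destruct (H x (fun P HP => HP) (mkposreal eps Heps)) as [delta Hd].
  exists delta; split; [apply cond_pos|]; intros y Hy; exact (Hd y Hy).
- intros H; split; [apply is_linear_scal_l|].
  intros x' Hx' eps.
  (* [is_derive] quantifies over all limits of the neighbourhood filter of [x]; the only one is [x]
     itself. *)
  assert (E := is_filter_lim_locally_unique _ _ Hx'); rewrite <- E.
  destruct (H eps (cond_pos eps)) as [delta [Hd Hd']].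
  exists (mkposreal delta Hd); intros y Hy; exact (Hd' y Hy).
Qed.

Lemma Cder_eps (f : C -> C) (z d : C) :
  Cder f z d <->
  forall eps : R, 0 < eps -> exists delta : R, 0 < delta /\ forall w : C,
    Cmod (w - z) < delta -> Cmod (f w - f z - (w - z) * d) <= eps * Cmod (w - z).
Proof. exact (is_derive_eps C_AbsRing C_NormedModule f z d). Qed.

Lemma Rder_eps (g : R -> C) (t : R) (d : C) :
  Rder g t d <->
  forall eps : R, 0 < eps -> exists delta : R, 0 < delta /\ forall s : R,
    Rabs (s - t) < delta -> Cmod (g s - g t - (s - t)%R * d) <= eps * Rabs (s - t).
Proof.
assert (E : forall s, (scal (minus s t) d : C_R_NormedModule) = ((s - t)%R * d)%C)
  by (intros s; apply scal_R_Cmult).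
split; intros H.
- intros eps He; destruct (proj1 (is_derive_eps _ _ _ _ _) H eps He) as [de [Hd1 Hd2]].
  exists de; split; [exact Hd1|]; intros s Hs.
  generalize (Hd2 s Hs); rewrite E, <- Cmod_norm; exact (fun h => h).
- apply is_derive_eps; intros eps He; destruct (H eps He) as [de [Hd1 Hd2]].
  exists de; split; [exact Hd1|]; intros s Hs.
  rewrite E, <- Cmod_norm; exact (Hd2 s Hs).
Qed.

(** [C_NormedModule] and the ring as a module over itself carry the same norm, so their epsilon
    forms coincide. The product and chain rules are taken from the second module. *)
Lemma Cder_AbsRing (f : C -> C) (z d : C) :
  Cder f z d <-> @is_derive C_AbsRing (AbsRing_NormedModule C_AbsRing) f z d.
Proof.
rewrite Cder_eps; symmetry.
exact (is_derive_eps C_AbsRing (AbsRing_NormedModule C_AbsRing) f z d).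
Qed.

Lemma Cder_const (c z : C) : Cder (fun _ => c) z (RtoC 0).
Proof. apply Cder_AbsRing; exact (is_derive_const (K := C_AbsRing) (V := AbsRing_NormedModule C_AbsRing) c z). Qed.

Lemma Cder_id (z : C) : Cder (fun w => w) z (RtoC 1).
Proof. apply Cder_AbsRing; exact (is_derive_id (K := C_AbsRing) z). Qed.

Lemma Cder_plus (f g : C -> C) (z df dg : C) :
  Cder f z df -> Cder g z dg -> Cder (fun w => f w + g w)%C z (df + dg)%C.
Proof. exact (is_derive_plus (K := C_AbsRing) (V := C_NormedModule) f g z df dg). Qed.

Lemma Cder_minus (f g : C -> C) (z df dg : C) :
  Cder f z df -> Cder g z dg -> Cder (fun w => f w - g w)%C z (df - dg)%C.
Proof. exact (is_derive_minus (K := C_AbsRing) (V := C_NormedModule) f g z df dg). Qed.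

Lemma Cder_mult (f g : C -> C) (z df dg : C) :
  Cder f z df -> Cder g z dg ->
  Cder (fun w => f w * g w)%C z (df * g z + f z * dg)%C.
Proof.
rewrite !Cder_AbsRing; intros Hf Hg.
exact (is_derive_mult (K := C_AbsRing) f g z df dg Hf Hg Cmult_comm).
Qed.

Lemma Cder_comp (f g : C -> C) (z df dg : C) :
  Cder f (g z) df -> Cder g z dg -> Cder (fun w => f (g w)) z (dg * df)%C.
Proof.
rewrite !Cder_AbsRing; intros Hf Hg.
exact (is_derive_comp (K := C_AbsRing) (V := AbsRing_NormedModule C_AbsRing) f g z df dg Hf Hg).
Qed.

Lemma Cder_scal (c : C) (f : C -> C) (z df : C) :
  Cder f z df -> Cder (fun w => c * f w)%C z (c * df)%C.
Proof.
intros H; generalize (Cder_mult _ _ _ _ _ (Cder_const c z) H).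
replace (0 * f z + c * df)%C with (c * df)%C by ring; exact (fun h => h).
Qed.

Lemma Cder_eq (f : C -> C) (z d d' : C) : d = d' -> Cder f z d -> Cder f z d'.
Proof. intros ->; exact (fun h => h). Qed.

Lemma Cder_ext_ball (f g : C -> C) (z d : C) (r : R) :
  0 < r -> (forall w, Cmod (w - z) < r -> f w = g w) -> Cder f z d -> Cder g z d.
Proof.
intros Hr E H.
apply (is_derive_ext_loc (K := C_AbsRing) (V := C_NormedModule) f g z d); [|exact H].
exists (mkposreal r Hr); intros w Hw; exact (E w Hw).
Qed.

Lemma Cder_unique (f : C -> C) (z d d' : C) : Cder f z d -> Cder f z d' -> d = d'.
Proof.
intros H H'; apply is_C_derive_unique in H; apply is_C_derive_unique in H'; congruence.
Qed.

Lemma cont_eps (f : C -> C) (z : C) :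
  continuous (T := CU) (U := CU) f z <->
  forall eps : R, 0 < eps -> exists delta : R, 0 < delta /\ forall w : C,
    Cmod (w - z) < delta -> Cmod (f w - f z) < eps.
Proof.
split.
- intros H eps He.
  destruct (proj1 (filterlim_locally (F := locally (z : CU)) (U := CU) f (f z)) H (mkposreal eps He)) as [d Hd].
  exists d; split; [apply cond_pos|]; intros w Hw; exact (Hd w Hw).
- intros H; apply (filterlim_locally (F := locally (z : CU)) (U := CU) f (f z)); intros eps.
  destruct (H eps (cond_pos eps)) as [d [Hd Hd']].
  exists (mkposreal d Hd); intros w Hw; exact (Hd' w Hw).
Qed.

Lemma Cder_cont (f : C -> C) (z d : C) : Cder f z d -> continuous (T := CU) (U := CU) f z.
Proof.
rewrite Cder_AbsRing; intros H.
apply (ex_derive_continuous (K := C_AbsRing) (V := AbsRing_NormedModule C_AbsRing)); exists d; exact H.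
Qed.

Section Cont.
Context {T : UniformSpace}.

Lemma cont_plus (f g : T -> C) (x : T) :
  continuous (U := CU) f x -> continuous (U := CU) g x ->
  continuous (U := CU) (fun y => f y + g y)%C x.
Proof. exact (continuous_plus (V := AbsRing_NormedModule C_AbsRing) f g x). Qed.

Lemma cont_minus (f g : T -> C) (x : T) :
  continuous (U := CU) f x -> continuous (U := CU) g x ->
  continuous (U := CU) (fun y => f y - g y)%C x.
Proof. exact (continuous_minus (V := AbsRing_NormedModule C_AbsRing) f g x). Qed.

Lemma cont_mult (f g : T -> C) (x : T) :
  continuous (U := CU) f x -> continuous (U := CU) g x ->
  continuous (U := CU) (fun y => f y * g y)%C x.
Proof. exact (continuous_mult (K := C_AbsRing) f g x). Qed.

Lemma cont_const (c : C) (x : T) : continuous (U := CU) (fun _ => c) x.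
Proof. exact (continuous_const (V := CU) c x). Qed.

Lemma cont_CU (f : T -> C) (x : T) :
  continuous (U := CU) f x <-> continuous (U := C_UniformSpace) f x.
Proof.
split; intros H P HP; apply H; apply (locally_C (f x) P); exact HP.
Qed.
End Cont.

Lemma Cder_inv (z : C) : z <> 0 -> Cder Cinv z (- / (z * z))%C.
Proof.
intros Hz; apply Cder_eps; intros eps He.
assert (Hm := proj1 (Cmod_gt_0 z) Hz).
set (m := Cmod z) in *.
(* The remainder is (w - z)^2 / (w z^2). The first bound gives |w| > m/2, and with it the second
   makes the remainder at most eps |w - z|. *)
exists (Rmin (m / 2) (eps * (m * m * m) / 2)); split.
{ apply Rmin_pos; [lra|]. repeat apply Rmult_lt_0_compat; lra. }
intros w Hw.
assert (H1 : Cmod (w - z) < m / 2) by (eapply Rlt_le_trans; [exact Hw|apply Rmin_l]).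
assert (H2 : Cmod (w - z) < eps * (m * m * m) / 2) by (eapply Rlt_le_trans; [exact Hw|apply Rmin_r]).
assert (Hwm : m / 2 < Cmod w).
{ generalize (Cmod_triangle w (- (w - z))); rewrite Cmod_opp.
  replace (w + - (w - z))%C with z by ring; fold m; lra. }
assert (Hw0 : w <> 0) by (apply Cmod_gt_0; lra).
replace (/ w - / z - (w - z) * - / (z * z))%C with ((w - z) * ((w - z) * / (w * (z * z))))%C
  by (field; split; assumption).
rewrite Rmult_comm, !Cmod_mult.
apply Rmult_le_compat_l; [apply Cmod_ge_0|].
rewrite Cmod_inv by (repeat apply Cmult_neq_0; assumption).
rewrite !Cmod_mult; fold m.
apply (Rmult_le_reg_r (Cmod w * (m * m))); [repeat apply Rmult_lt_0_compat; lra|].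
rewrite Rmult_assoc, Rinv_l, Rmult_1_r.
2:{ apply Rgt_not_eq; repeat apply Rmult_lt_0_compat; lra. }
apply Rle_trans with (eps * (m * m * m) / 2); [lra|].
replace (eps * (m * m * m) / 2) with ((eps * (m * m)) * (m / 2)) by field.
replace (eps * (Cmod w * (m * m))) with ((eps * (m * m)) * Cmod w) by ring.
apply Rmult_le_compat_l; [|lra].
repeat apply Rmult_le_pos; lra.
Qed.

(** The outer derivative is complex and the inner one real, so the chain rule is proved by hand.
    Near [t], [g] is Lipschitz with constant [B], which turns the error of [f] into eps/2 |s - t|;
    the error of [g], multiplied by [df], supplies the other half. *)
Lemma Rder_comp (f : C -> C) (g : R -> C) (t : R) (df dg : C) :
  Cder f (g t) df -> Rder g t dg -> Rder (fun s => f (g s)) t (dg * df)%C.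
Proof.
rewrite Cder_eps, !Rder_eps; intros Hf Hg eps He.
set (A := Cmod df + 1). set (B := Cmod dg + 1).
assert (HA : 0 < A) by (unfold A; generalize (Cmod_ge_0 df); lra).
assert (HB : 0 < B) by (unfold B; generalize (Cmod_ge_0 dg); lra).
destruct (Hf (eps / 2 / B)) as [d1 [Hd1 H1]].
{ repeat apply Rdiv_lt_0_compat; lra. }
set (e2 := Rmin 1 (eps / 2 / A)).
assert (He2 : 0 < e2).
{ apply Rmin_pos; [lra|]; repeat apply Rdiv_lt_0_compat; lra. }
destruct (Hg e2 He2) as [d2 [Hd2 H2]].
exists (Rmin d2 (d1 / B)); split.
{ apply Rmin_pos; [lra|]; apply Rdiv_lt_0_compat; lra. }
intros s Hs.
assert (Hs2 : Rabs (s - t) < d2) by (eapply Rlt_le_trans; [exact Hs|apply Rmin_l]).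
assert (Hs1 : Rabs (s - t) < d1 / B) by (eapply Rlt_le_trans; [exact Hs|apply Rmin_r]).
assert (G := H2 s Hs2).
assert (Hab := Rabs_pos (s - t)).
assert (L : Cmod (g s - g t) <= B * Rabs (s - t)).
{ replace (g s - g t)%C with ((g s - g t - (s - t)%R * dg) + (s - t)%R * dg)%C by ring.
  eapply Rle_trans; [apply Cmod_triangle|].
  rewrite Cmod_mult, Cmod_R; unfold B.
  assert (e2 * Rabs (s - t) <= 1 * Rabs (s - t)).
  { apply Rmult_le_compat_r; [assumption|apply Rmin_l]. }
  lra. }
assert (F : Cmod (f (g s) - f (g t) - (g s - g t) * df) <= eps / 2 / B * Cmod (g s - g t)).
{ apply H1. eapply Rle_lt_trans; [exact L|].
  apply (Rmult_lt_compat_l B) in Hs1; [|assumption].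
  replace (B * (d1 / B)) with d1 in Hs1 by (field; lra); exact Hs1. }
replace (f (g s) - f (g t) - (s - t)%R * (dg * df))%C
  with ((f (g s) - f (g t) - (g s - g t) * df) + (g s - g t - (s - t)%R * dg) * df)%C by ring.
eapply Rle_trans; [apply Cmod_triangle|]; rewrite Cmod_mult.
assert (F' : Cmod (f (g s) - f (g t) - (g s - g t) * df) <= eps / 2 * Rabs (s - t)).
{ eapply Rle_trans; [exact F|].
  replace (eps / 2 * Rabs (s - t)) with (eps / 2 / B * (B * Rabs (s - t))) by (field; lra).
  apply Rmult_le_compat_l; [|exact L]; apply Rlt_le; repeat apply Rdiv_lt_0_compat; lra. }
assert (G' : Cmod (g s - g t - (s - t)%R * dg) * Cmod df <= eps / 2 * Rabs (s - t)).
{ apply Rle_trans with ((eps / 2 / A * Rabs (s - t)) * A).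
  - apply Rmult_le_compat; try apply Cmod_ge_0; [|unfold A; lra].
    eapply Rle_trans; [exact G|]; apply Rmult_le_compat_r; [assumption|apply Rmin_r].
  - right; field; lra. }
lra.
Qed.

Lemma Rder_plus (f g : R -> C) (t : R) (df dg : C) :
  Rder f t df -> Rder g t dg -> Rder (fun s => f s + g s)%C t (df + dg)%C.
Proof. exact (is_derive_plus (K := R_AbsRing) (V := C_R_NormedModule) f g t df dg). Qed.

Lemma Rder_minus (f g : R -> C) (t : R) (df dg : C) :
  Rder f t df -> Rder g t dg -> Rder (fun s => f s - g s)%C t (df - dg)%C.
Proof. exact (is_derive_minus (K := R_AbsRing) (V := C_R_NormedModule) f g t df dg). Qed.

Lemma Rder_ext (f g : R -> C) (t : R) (d d' : C) :
  (forall s, f s = g s) -> d = d' -> Rder f t d -> Rder g t d'.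
Proof.
intros E <- H; apply (is_derive_ext (K := R_AbsRing) (V := C_R_NormedModule) f g t d); auto.
Qed.

Lemma Rder_mult (f g : R -> C) (t : R) (df dg : C) :
  Rder f t df -> Rder g t dg ->
  Rder (fun s => f s * g s)%C t (df * g t + f t * dg)%C.
Proof.
(* Polarization reduces products to the chain rule for [w * w]. *)
intros Hf Hg.
assert (Sq : forall h dh, Rder h t dh -> Rder (fun s => h s * h s)%C t (dh * (1 * h t + h t * 1))%C).
{ intros h dh Hh.
  exact (Rder_comp _ _ _ _ _ (Cder_mult _ _ _ _ _ (Cder_id (h t)) (Cder_id (h t))) Hh). }
assert (H1 := Sq _ _ (Rder_plus _ _ _ _ _ Hf Hg)).
assert (H2 := Sq _ _ (Rder_minus _ _ _ _ _ Hf Hg)).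
assert (H4 := Rder_comp (fun w => / 4 * w)%C _ _ _ _ (Cder_scal (/ 4)%C _ _ _ (Cder_id _)) (Rder_minus _ _ _ _ _ H1 H2)).
assert (N4 : (4 : C) <> 0) by (intros E; apply RtoC_inj in E; lra).
refine (Rder_ext _ _ _ _ _ _ _ H4); [intros s; simpl|]; field; exact N4.
Qed.

Lemma Rder_line (z v : C) (t : R) : Rder (fun s => z + s * v)%C t v.
Proof.
apply Rder_eps; intros eps He; exists 1; split; [lra|]; intros s _.
replace (z + s * v - (z + t * v) - (s - t)%R * v)%C with (RtoC 0).
2:{ rewrite RtoC_minus; ring. }
rewrite Cmod_0; apply Rmult_le_pos; [lra|apply Rabs_pos].
Qed.

Lemma Rder_cont (g : R -> C) (t : R) (d : C) : Rder g t d -> continuous (U := CU) g t.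
Proof.
intros H; apply cont_CU.
apply (ex_derive_continuous (K := R_AbsRing) (V := C_R_NormedModule)); exists d; exact H.
Qed.

Lemma Rder_mean_value (g : R -> C) (dg : R -> C) (a b K : R) :
  a <= b -> (forall t, a <= t <= b -> Rder g t (dg t)) ->
  (forall t, a <= t <= b -> Cmod (dg t) <= K) ->
  Cmod (g b - g a) <= K * (b - a).
Proof.
(* The mean value theorem for the real function [Re (conj D * g)], where [D := g b - g a]. *)
intros Hab Hg HK.
set (D := (g b - g a)%C).
set (p := fun t => Re (Cconj D * g t)%C).
assert (Hp : forall t, a <= t <= b -> is_derive p t (Re (Cconj D * dg t)%C)).
{ intros t Ht; apply (proj2 (is_derive_eps R_AbsRing R_NormedModule p t _)); intros eps He.
  assert (HD : 0 < Cmod D + 1) by (generalize (Cmod_ge_0 D); lra).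
  destruct (proj1 (Rder_eps _ _ _) (Hg t Ht) (eps / (Cmod D + 1))) as [d [Hd Hd']].
  { apply Rdiv_lt_0_compat; lra. }
  exists d; split; [exact Hd|]; intros s Hs.
  change (Rabs (p s - p t - (s - t) * Re (Cconj D * dg t)) <= eps * Rabs (s - t)).
  replace (p s - p t - (s - t) * Re (Cconj D * dg t))
    with (Re (Cconj D * (g s - g t - (s - t)%R * dg t))%C).
  2:{ unfold p, Re; simpl; ring. }
  eapply Rle_trans; [apply re_le_Cmod|]; rewrite Cmod_mult, Cmod_conj.
  apply Rle_trans with ((Cmod D + 1) * (eps / (Cmod D + 1) * Rabs (s - t))).
  - apply Rmult_le_compat; try apply Cmod_ge_0; [lra|]; exact (Hd' s Hs).
  - right; field; lra. }
destruct (MVT_gen p a b (fun t => Re (Cconj D * dg t)%C)) as [c [Hc E]].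
- intros t Ht; rewrite Rmin_left, Rmax_right in Ht by assumption; apply Hp; lra.
- intros t Ht; rewrite Rmin_left, Rmax_right in Ht by assumption.
  apply continuity_pt_filterlim, (ex_derive_continuous (K := R_AbsRing) (V := R_NormedModule)).
  exists (Re (Cconj D * dg t)%C); apply Hp; lra.
- rewrite Rmin_left, Rmax_right in Hc by assumption.
  assert (E2 : Cmod D * Cmod D = Re (Cconj D * dg c)%C * (b - a)).
  { rewrite <- E; replace (Cmod D * Cmod D) with (Cmod D ^ 2) by ring.
    rewrite Cmod2_alt; unfold p, D, Re, Im; simpl; ring. }
  assert (E3 : Re (Cconj D * dg c)%C <= Cmod D * K).
  { eapply Rle_trans; [apply Rle_abs|]; eapply Rle_trans; [apply re_le_Cmod|].
    rewrite Cmod_mult, Cmod_conj; apply Rmult_le_compat_l; [apply Cmod_ge_0|apply HK, Hc]. }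
  assert (HK0 : 0 <= K) by (eapply Rle_trans; [apply Cmod_ge_0|apply (HK c Hc)]).
  destruct (Cmod_ge_0 D) as [HD|HD].
  + apply (Rmult_le_reg_l (Cmod D)); [exact HD|]; rewrite E2.
    apply Rle_trans with (Cmod D * K * (b - a)); [|right; ring].
    apply Rmult_le_compat_r; lra.
  + rewrite <- HD; apply Rmult_le_pos; lra.
Qed.

Lemma segment_ball (z0 z w : C) (r s : R) :
  Cmod (z - z0) < r -> Cmod (w - z0) < r -> 0 <= s <= 1 ->
  Cmod (z + s * (w - z) - z0) < r.
Proof.
intros Hz Hw Hs.
replace (z + s * (w - z) - z0)%C with ((1 - s)%R * (z - z0) + s * (w - z0))%C
  by (rewrite RtoC_minus; ring).
eapply Rle_lt_trans; [apply Cmod_triangle|].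
rewrite !Cmod_mult, !Cmod_R, !Rabs_pos_eq by lra.
(* One of the weights 1 - s and s is positive, and its term keeps the inequality strict. *)
destruct (Rle_lt_dec s (1 / 2)).
- apply Rlt_le_trans with ((1 - s) * r + s * r); [|right; ring].
  apply Rplus_lt_le_compat; [apply Rmult_lt_compat_l|apply Rmult_le_compat_l]; lra.
- apply Rlt_le_trans with ((1 - s) * r + s * r); [|right; ring].
  apply Rplus_le_lt_compat; [apply Rmult_le_compat_l|apply Rmult_lt_compat_l]; lra.
Qed.

Lemma Cder_mean_value (f f' : C -> C) (z0 : C) (r K : R) :
  (forall z, Cmod (z - z0) < r -> Cder f z (f' z)) ->
  (forall z, Cmod (z - z0) < r -> Cmod (f' z) <= K) ->
  forall z w, Cmod (z - z0) < r -> Cmod (w - z0) < r ->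
  Cmod (f w - f z) <= K * Cmod (w - z).
Proof.
intros Hf HK z w Hz Hw.
assert (H := Rder_mean_value (fun s => f (z + s * (w - z))%C)
  (fun s => (w - z) * f' (z + s * (w - z)))%C 0 1 (K * Cmod (w - z)) Rle_0_1).
cbv beta in H.
replace (z + 1%R * (w - z))%C with w in H by ring.
replace (z + 0%R * (w - z))%C with z in H by ring.
replace (K * Cmod (w - z)) with (K * Cmod (w - z) * (1 - 0)) by ring.
apply H; intros t Ht.
- apply Rder_comp; [apply Hf, segment_ball; assumption|apply Rder_line].
- rewrite Cmod_mult, Rmult_comm; apply Rmult_le_compat_r; [apply Cmod_ge_0|].
  apply HK, segment_ball; assumption.
Qed.

(** * The complex exponential *)

Definition cexp (z : C) : C := (exp (Re z) * cos (Im z), exp (Re z) * sin (Im z)).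

Lemma cexp_plus (z w : C) : cexp (z + w) = (cexp z * cexp w)%C.
Proof.
unfold cexp, Cmult, Re, Im; simpl; rewrite exp_plus, cos_plus, sin_plus.
f_equal; ring.
Qed.

Lemma cexp_0 : cexp 0 = 1.
Proof. unfold cexp; simpl; rewrite exp_0, cos_0, sin_0; unfold RtoC; f_equal; ring. Qed.

Lemma Cmod_cexp (z : C) : Cmod (cexp z) = exp (Re z).
Proof.
unfold Cmod, cexp; simpl fst; simpl snd.
replace (_ + _) with (exp (Re z) ^ 2 * (Rsqr (sin (Im z)) + Rsqr (cos (Im z)))) by (unfold Rsqr; ring).
rewrite sin2_cos2, Rmult_1_r; apply sqrt_pow2, Rlt_le, exp_pos.
Qed.

Lemma cexp_opp (z : C) : (cexp z * cexp (- z) = 1)%C.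
Proof. rewrite <- cexp_plus, Cplus_opp_r; apply cexp_0. Qed.

Lemma cexp_periodic : cexp (2 * PI * Ci) = 1.
Proof.
unfold cexp; replace (Re (2 * PI * Ci)%C) with 0 by (simpl; ring).
replace (Im (2 * PI * Ci)%C) with (2 * PI) by (simpl; ring).
rewrite exp_0, cos_2PI, sin_2PI; unfold RtoC; f_equal; ring.
Qed.

Lemma cexp_pow (z : C) (m : nat) : (cexp z ^ m)%C = cexp (INR m * z).
Proof.
induction m as [|m IH].
- simpl; rewrite Cmult_0_l, cexp_0; reflexivity.
- rewrite S_INR, RtoC_plus; simpl Cpow; rewrite IH.
  replace ((INR m + 1) * z)%C with (z + INR m * z)%C by ring; rewrite cexp_plus; reflexivity.
Qed.

Lemma Cder_cexp_0 : Cder cexp (RtoC 0) (RtoC 1).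
Proof.
apply Cder_eps; intros eps He.
(* The remainder splits below into four terms, bounded by 2e|w|, 2e|w|, e|w| and e|w|, hence
   [eps / 8]. The bound 1/2 keeps exp x below 2. *)
set (e := Rmin (1 / 2) (eps / 8)).
assert (He1 : 0 < e) by (apply Rmin_pos; lra).
assert (He2 : e <= 1 / 2) by apply Rmin_l.
assert (He3 : e <= eps / 8) by apply Rmin_r.
assert (D : forall (h : R -> R) (l : R), is_derive h 0 l -> exists d, 0 < d /\
  forall x, Rabs x < d -> Rabs (h x - h 0 - x * l) <= e * Rabs x).
{ intros h l Hh.
  destruct (proj1 (is_derive_eps R_AbsRing R_NormedModule h 0 l) Hh e He1) as [d [Hd H]].
  exists d; split; [exact Hd|]; intros x Hx.
  generalize (H x : Rabs (x - 0) < d -> Rabs (h x - h 0 - (x - 0) * l) <= e * Rabs (x - 0)).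
  rewrite Rminus_0_r; auto. }
destruct (D exp 1) as [d1 [Hd1 H1]].
{ rewrite <- exp_0; apply is_derive_exp. }
destruct (D cos 0) as [d2 [Hd2 H2]].
{ replace 0 with (- sin 0) at 2 by (rewrite sin_0; ring); apply is_derive_cos. }
destruct (D sin 1) as [d3 [Hd3 H3]].
{ rewrite <- cos_0; apply is_derive_sin. }
exists (Rmin (Rmin d1 (e / 2)) (Rmin d2 d3)); split.
{ repeat apply Rmin_pos; lra. }
intros w; rewrite cexp_0.
replace (w - 0)%C with w by ring; replace (w * 1)%C with w by ring; intros Hw.
assert (Hx := re_le_Cmod w).
assert (Hy : Rabs (Im w) <= Cmod w).
{ eapply Rle_trans; [|apply Rmax_Cmod]; apply Rmax_r. }
assert (M1 := Rmin_l (Rmin d1 (e / 2)) (Rmin d2 d3)).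
assert (M2 := Rmin_r (Rmin d1 (e / 2)) (Rmin d2 d3)).
assert (M3 := Rmin_l d1 (e / 2)); assert (M4 := Rmin_r d1 (e / 2)).
assert (M5 := Rmin_l d2 d3); assert (M6 := Rmin_r d2 d3).
specialize (H1 (Re w) ltac:(lra)); specialize (H2 (Im w) ltac:(lra)); specialize (H3 (Im w) ltac:(lra)).
rewrite exp_0, Rmult_1_r in H1; rewrite cos_0, Rmult_0_r, Rminus_0_r in H2.
rewrite sin_0, Rminus_0_r, Rmult_1_r in H3.
set (x := Re w) in *; set (y := Im w) in *; set (m := Cmod w) in *.
assert (Hx0 := Rabs_pos x); assert (Hy0 := Rabs_pos y).
assert (Hm0 : 0 <= m) by lra.
assert (E1 : Rabs (exp x - 1) <= e).
{ replace (exp x - 1) with ((exp x - 1 - x) + x) by ring.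
  eapply Rle_trans; [apply Rabs_triang|].
  assert (e * Rabs x <= 1 / 2 * Rabs x) by (apply Rmult_le_compat_r; lra). lra. }
assert (E2 : 0 < exp x <= 2).
{ split; [apply exp_pos|]. apply Rabs_le_between in E1; lra. }
replace (cexp w - 1 - w)%C with
  (exp x * (cos y - 1)%R + Ci * (exp x * (sin y - y)%R) + (exp x - 1 - x)%R + Ci * (y * (exp x - 1)%R))%C.
2:{ destruct w as [u v]; unfold x, y, cexp; apply injective_projections; simpl; ring. }
assert (T : forall a b c d : C, Cmod (a + b + c + d) <= Cmod a + Cmod b + Cmod c + Cmod d).
{ intros a b c d; generalize (Cmod_triangle (a + b + c) d) (Cmod_triangle (a + b) c) (Cmod_triangle a b); lra. }
eapply Rle_trans; [apply T|].
rewrite !Cmod_mult, Cmod_Ci, !Cmod_R, (Rabs_pos_eq (exp x)) by lra.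
assert (exp x * Rabs (cos y - 1) <= 2 * (e * Rabs y)) by (apply Rmult_le_compat; try apply Rabs_pos; lra).
assert (exp x * Rabs (sin y - y) <= 2 * (e * Rabs y)) by (apply Rmult_le_compat; try apply Rabs_pos; lra).
assert (Rabs y * Rabs (exp x - 1) <= m * e) by (apply Rmult_le_compat; try apply Rabs_pos; lra).
assert (e * Rabs y <= e * m) by (apply Rmult_le_compat_l; lra).
assert (e * Rabs x <= e * m) by (apply Rmult_le_compat_l; lra).
assert (e * m <= eps / 8 * m) by (apply Rmult_le_compat_r; lra).
assert (0 <= eps * m) by (apply Rmult_le_pos; lra).
lra.
Qed.

Lemma Cder_cexp (z : C) : Cder cexp z (cexp z).
Proof.
assert (H0 : Cder (fun w => w - z)%C z (1 - 0)%C) by (apply Cder_minus; [apply Cder_id|apply Cder_const]).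
assert (H1 : Cder cexp (z - z)%C (RtoC 1)).
{ replace (z - z)%C with (RtoC 0) by ring; apply Cder_cexp_0. }
assert (H := Cder_scal (cexp z) _ _ _ (Cder_comp cexp (fun w => w - z)%C z _ _ H1 H0)).
apply (Cder_eq _ _ (cexp z * ((1 - 0) * 1))%C); [ring|].
refine (Cder_ext_ball _ _ _ _ 1 Rlt_0_1 _ H).
intros w _; rewrite <- cexp_plus; f_equal; ring.
Qed.

(** * Integrals with a complex parameter *)

Lemma CInt_correct (f : R -> C) (a b : R) :
  a <= b -> (forall t, a <= t <= b -> continuous (U := CU) f t) -> is_CInt f a b (CInt f a b).
Proof.
intros Hab Hf; apply (RInt_correct (V := C_R_CompleteNormedModule)).
apply (ex_RInt_continuous (V := C_R_CompleteNormedModule)).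
rewrite Rmin_left, Rmax_right by assumption.
intros t Ht; apply (proj1 (cont_CU f t)), Hf, Ht.
Qed.

Lemma is_CInt_unique (f : R -> C) (a b : R) (l : C) : is_CInt f a b l -> CInt f a b = l.
Proof. exact (is_RInt_unique (V := C_R_CompleteNormedModule) f a b l). Qed.

(** A complex constant is not a scalar of the real module [C_R_NormedModule], so real and imaginary
    parts are integrated separately. *)
Lemma is_CInt_scal (c : C) (f : R -> C) (a b : R) (l : C) :
  is_CInt f a b l -> is_CInt (fun t => c * f t)%C a b (c * l)%C.
Proof.
intros H.
assert (H1 := is_RInt_fct_extend_fst (U := R_NormedModule) (V := R_NormedModule) _ _ _ _ H).
assert (H2 := is_RInt_fct_extend_snd (U := R_NormedModule) (V := R_NormedModule) _ _ _ _ H).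
apply (is_RInt_fct_extend_pair (U := R_NormedModule) (V := R_NormedModule)); simpl.
- exact (is_RInt_minus _ _ _ _ _ _ (is_RInt_scal _ _ _ (fst c) _ H1) (is_RInt_scal _ _ _ (snd c) _ H2)).
- exact (is_RInt_plus _ _ _ _ _ _ (is_RInt_scal _ _ _ (fst c) _ H2) (is_RInt_scal _ _ _ (snd c) _ H1)).
Qed.

Lemma is_CInt_plus (f g : R -> C) (a b : R) (l m : C) :
  is_CInt f a b l -> is_CInt g a b m -> is_CInt (fun t => f t + g t)%C a b (l + m)%C.
Proof. exact (is_RInt_plus (V := C_R_NormedModule) f g a b l m). Qed.

Lemma is_CInt_minus (f g : R -> C) (a b : R) (l m : C) :
  is_CInt f a b l -> is_CInt g a b m -> is_CInt (fun t => f t - g t)%C a b (l - m)%C.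
Proof. exact (is_RInt_minus (V := C_R_NormedModule) f g a b l m). Qed.

Lemma is_CInt_derive (f df : R -> C) (a b : R) :
  a <= b -> (forall t, a <= t <= b -> Rder f t (df t)) ->
  (forall t, a <= t <= b -> continuous (U := CU) df t) ->
  is_CInt df a b (f b - f a)%C.
Proof.
intros Hab Hf Hdf; apply (is_RInt_derive (V := C_R_CompleteNormedModule) f df);
  rewrite Rmin_left, Rmax_right by assumption; intros t Ht.
- apply Hf, Ht.
- apply (proj1 (cont_CU df t)), Hdf, Ht.
Qed.

Lemma is_CInt_norm_le (f : R -> C) (a b M : R) (l : C) :
  a <= b -> (forall t, a <= t <= b -> Cmod (f t) <= M) -> is_CInt f a b l ->
  Cmod l <= (b - a) * M.
Proof.
intros Hab Hf H; rewrite Cmod_norm.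
apply (norm_RInt_le_const (V := C_R_NormedModule) f a b l M Hab); [|exact H].
intros t Ht; generalize (Hf t Ht); rewrite Cmod_norm; exact (fun h => h).
Qed.

(** This is compactness of [a, b]: the radii given by continuity at the points (z0, t) have a common
    lower bound on a finite cover, and on each piece [G z t] and [G z0 t] are both within eps/2 of
    [G z0 s]. *)
Lemma joint_continuity_uniform (G : C -> R -> C) (a b : R) (z0 : C) :
  (forall t, a <= t <= b ->
    continuous (T := prod_UniformSpace CU R_UniformSpace) (U := CU)
      (fun p => G (fst p) (snd p)) (z0, t)) ->
  forall eps, 0 < eps -> exists delta, 0 < delta /\ forall t z, a <= t <= b ->
    Cmod (z - z0) < delta -> Cmod (G z t - G z0 t) <= eps.
Proof.
intros HG eps He.
assert (HG' : forall t, exists d : posreal, a <= t <= b -> forall z s,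
  Cmod (z - z0) < d -> Rabs (s - t) < d -> Cmod (G z s - G z0 t) < eps / 2).
{ intros t; destruct (classic (a <= t <= b)) as [Ht|Ht].
  2:{ exists (mkposreal 1 Rlt_0_1); intros; contradiction. }
  assert (He2 : 0 < eps / 2) by lra.
  destruct (proj1 (filterlim_locally _ _) (HG t Ht) (mkposreal _ He2)) as [d Hd].
  exists d; intros _ z s Hz Hs; exact (Hd (z, s) (conj Hz Hs)). }
set (delta := fun t => proj1_sig (constructive_indefinite_description _ (HG' t))).
assert (Hdelta : forall t, a <= t <= b -> forall z s,
  Cmod (z - z0) < delta t -> Rabs (s - t) < delta t -> Cmod (G z s - G z0 t) < eps / 2).
{ intros t; unfold delta; destruct (constructive_indefinite_description _ (HG' t)); assumption. }
destruct (compactness_value_1d a b delta) as [d Hd].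
exists d; split; [apply cond_pos|]; intros t z Ht Hz.
(* [compactness_value_1d] yields the covering point [s] only under a double negation, so the
   inequality is proved by contradiction. *)
apply Rnot_lt_le; intros Hlt; apply (Hd t Ht); intros [s [Hs [Hts Hds]]].
assert (Hz' : Cmod (z - z0) < delta s) by lra.
assert (H1 := Hdelta s Hs z t Hz' Hts).
assert (H2 := Hdelta s Hs z0 t).
replace (z0 - z0)%C with (RtoC 0) in H2 by ring; rewrite Cmod_0 in H2.
specialize (H2 (cond_pos _) Hts).
assert (H3 := Cmod_triangle (G z t - G z0 s) (- (G z0 t - G z0 s))).
rewrite Cmod_opp in H3.
replace (G z t - G z0 s + - (G z0 t - G z0 s))%C with (G z t - G z0 t)%C in H3 by ring.
lra.
Qed.

(** For fixed t, the function [G z t - z * G' z0 t] has derivative [G' z t - G' z0 t], which is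
    small uniformly in t. The mean value inequality bounds the first-order remainder of the
    integrand, and integration preserves the bound. *)
Lemma Cder_CInt (G G' : C -> R -> C) (a b : R) (z0 : C) (r : R) :
  a <= b -> 0 < r ->
  (forall z t, Cmod (z - z0) < r -> a <= t <= b -> Cder (fun w => G w t) z (G' z t)) ->
  (forall z t, Cmod (z - z0) < r -> a <= t <= b -> continuous (U := CU) (G z) t) ->
  (forall t, a <= t <= b ->
    continuous (T := prod_UniformSpace CU R_UniformSpace) (U := CU)
      (fun p => G' (fst p) (snd p)) (z0, t)) ->
  Cder (fun z => CInt (G z) a b) z0 (CInt (G' z0) a b).
Proof.
intros Hab Hr HG HGc HG'.
assert (HG'0 : forall t, a <= t <= b -> continuous (U := CU) (G' z0) t).
{ intros t Ht.
  refine (@continuous_comp R_UniformSpace (prod_UniformSpace CU R_UniformSpace) CU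
    (fun s => (z0, s)) (fun p => G' (fst p) (snd p)) t _ (HG' t Ht)).
  apply filterlim_locally; intros eps; exists eps; intros s Hs; split; [apply ball_center|exact Hs]. }
assert (Hz0 : Cmod (z0 - z0) < r).
{ replace (z0 - z0)%C with (RtoC 0) by ring; rewrite Cmod_0; assumption. }
apply Cder_eps; intros eps He.
(* The summand 1 keeps the denominator positive when a = b. *)
destruct (joint_continuity_uniform G' a b z0 HG' (eps / (b - a + 1))) as [d [Hd H]].
{ apply Rdiv_lt_0_compat; lra. }
exists (Rmin d r); split; [apply Rmin_pos; assumption|]; intros w Hw.
assert (Hw1 : Cmod (w - z0) < d) by (eapply Rlt_le_trans; [exact Hw|apply Rmin_l]).
assert (Hw2 : Cmod (w - z0) < r) by (eapply Rlt_le_trans; [exact Hw|apply Rmin_r]).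
assert (I := is_CInt_minus _ _ _ _ _ _
  (is_CInt_minus _ _ _ _ _ _
    (CInt_correct (G w) a b Hab (fun t => HGc w t Hw2))
    (CInt_correct (G z0) a b Hab (fun t => HGc z0 t Hz0)))
  (is_CInt_scal (w - z0) _ _ _ _ (CInt_correct (G' z0) a b Hab HG'0))).
apply Rle_trans with ((b - a) * (eps / (b - a + 1) * Cmod (w - z0))).
- refine (is_CInt_norm_le _ a b _ _ Hab _ I); intros t Ht.
  set (rho := Rmin d r) in *.
  assert (M := Cder_mean_value (fun z => G z t - z * G' z0 t)%C
    (fun z => G' z t - (1 * G' z0 t + z * 0))%C z0 rho (eps / (b - a + 1))).
  replace (G w t - G z0 t - (w - z0) * G' z0 t)%C
    with (G w t - w * G' z0 t - (G z0 t - z0 * G' z0 t))%C by ring.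
  assert (Hrho : 0 < rho) by (apply Rmin_pos; assumption).
  apply M; [| |replace (z0 - z0)%C with (RtoC 0) by ring; rewrite Cmod_0; exact Hrho|exact Hw].
  + intros z Hz; apply Cder_minus.
    * apply HG; [eapply Rlt_le_trans; [exact Hz|apply Rmin_r]|exact Ht].
    * exact (Cder_mult _ _ _ _ _ (Cder_id z) (Cder_const (G' z0 t) z)).
  + intros z Hz; replace (G' z t - (1 * G' z0 t + z * 0))%C with (G' z t - G' z0 t)%C by ring.
    apply H; [exact Ht|]; eapply Rlt_le_trans; [exact Hz|apply Rmin_l].
- assert (0 <= Cmod (w - z0)) by apply Cmod_ge_0.
  replace (eps * Cmod (w - z0)) with ((b - a + 1) * (eps / (b - a + 1) * Cmod (w - z0))) by (field; lra).
  apply Rmult_le_compat_r; [|lra].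
  apply Rmult_le_pos; [|assumption]; apply Rlt_le, Rdiv_lt_0_compat; lra.
Qed.

(** * Cauchy's formula for the derivative *)

Definition Cball (z0 : C) (r : R) : C -> Prop := fun z => Cmod (z - z0) < r.

Definition Copen (D : C -> Prop) : Prop :=
  forall z, D z -> exists r, 0 < r /\ forall w, Cball z r w -> D w.

(** The derivative is an explicit argument, so [C1_on D F f] also says that [F] is a primitive of
    the continuous function [f]. *)
Definition C1_on (D : C -> Prop) (f f' : C -> C) : Prop :=
  forall z, D z -> Cder f z (f' z) /\ continuous (T := CU) (U := CU) f' z.

Lemma Cball_center (z : C) (r : R) : 0 < r -> Cball z r z.
Proof.
intros Hr; unfold Cball; replace (z - z)%C with (RtoC 0) by ring; rewrite Cmod_0; exact Hr.
Qed.

Lemma Cball_trans (z0 z w : C) (r s : R) : Cball z0 r z -> Cball z s w -> Cball z0 (r + s) w.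
Proof.
unfold Cball; intros H1 H2.
replace (w - z0)%C with ((w - z) + (z - z0))%C by ring.
eapply Rle_lt_trans; [apply Cmod_triangle|lra].
Qed.

Lemma Copen_Cball (z0 : C) (r : R) : Copen (Cball z0 r).
Proof.
intros z Hz; exists (r - Cmod (z - z0)); split; [unfold Cball in Hz; lra|].
intros w Hw; unfold Cball in *.
replace (w - z0)%C with ((w - z) + (z - z0))%C by ring.
eapply Rle_lt_trans; [apply Cmod_triangle|lra].
Qed.

(** The affine form covers the three paths that are differentiated later: circles with moving
    centre, circles about a fixed centre with moving radius, and segments from the centre of a
    disc. *)
Lemma Cder_CInt_affine (f f' : C -> C) (A B K : R -> C) (a b : R) (w0 : C) (r : R) :
  a <= b -> 0 < r ->
  (forall t, continuous (U := CU) A t) -> (forall t, continuous (U := CU) B t) ->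
  (forall t, continuous (U := CU) K t) ->
  (forall w t, Cball w0 r w -> a <= t <= b ->
     Cder f (A t + w * B t)%C (f' (A t + w * B t)%C) /\
     continuous (T := CU) (U := CU) f' (A t + w * B t)%C) ->
  Cder (fun w => CInt (fun t => f (A t + w * B t) * K t)%C a b) w0
    (CInt (fun t => B t * f' (A t + w0 * B t) * K t)%C a b).
Proof.
intros Hab Hr HA HB HK Hf.
apply (Cder_CInt (fun w t => f (A t + w * B t) * K t)%C
  (fun w t => B t * f' (A t + w * B t) * K t)%C a b w0 r Hab Hr).
- intros z t Hz Ht.
  assert (HL : Cder (fun w => A t + w * B t)%C z (0 + (1 * B t + z * 0))%C).
  { exact (Cder_plus _ _ _ _ _ (Cder_const (A t) z) (Cder_mult _ _ _ _ _ (Cder_id z) (Cder_const (B t) z))). }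
  assert (HM := Cder_mult _ _ _ _ _ (Cder_comp f _ z _ _ (proj1 (Hf z t Hz Ht)) HL) (Cder_const (K t) z)).
  refine (Cder_eq _ _ _ _ _ HM); ring.
- intros z t Hz Ht; apply cont_mult; [|apply HK].
  refine (@continuous_comp R_UniformSpace CU CU (fun t => A t + z * B t)%C f t _ _).
  + apply cont_plus; [apply HA|]; apply cont_mult; [apply cont_const|apply HB].
  + apply (Cder_cont _ _ _ (proj1 (Hf z t Hz Ht))).
- intros t Ht.
  assert (L : forall E : R -> C, continuous (U := CU) E t ->
    @continuous (prod_UniformSpace CU R_UniformSpace) CU (fun p => E (snd p)) (w0, t)).
  { intros E HE.
    refine (@continuous_comp (prod_UniformSpace CU R_UniformSpace) R_UniformSpace CU snd E (w0, t) _ HE).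
    exact (@continuous_snd CU R_UniformSpace w0 t). }
  apply (@cont_mult (prod_UniformSpace CU R_UniformSpace)); [|apply L, HK].
  apply (@cont_mult (prod_UniformSpace CU R_UniformSpace)); [apply L, HB|].
  refine (@continuous_comp (prod_UniformSpace CU R_UniformSpace) CU CU
    (fun p => A (snd p) + fst p * B (snd p))%C f' (w0, t) _ _).
  + apply (@cont_plus (prod_UniformSpace CU R_UniformSpace)); [apply L, HA|].
    apply (@cont_mult (prod_UniformSpace CU R_UniformSpace)); [|apply L, HB].
    exact (@continuous_fst CU R_UniformSpace w0 t).
  + exact (proj2 (Hf w0 t (Cball_center w0 r Hr) Ht)).
Qed.

(** * Fourier coefficients on circles *)

Definition cis (k : R) (t : R) : C := cexp (k * t * Ci).

Lemma Rder_cis (k t : R) : Rder (cis k) t (k * Ci * cis k t)%C.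
Proof.
assert (H := Rder_comp cexp (fun s => 0 + s * (k * Ci))%C t _ _ (Cder_cexp _) (Rder_line 0 (k * Ci) t)).
assert (E : forall s : R, (0 + s * (k * Ci) = k * s * Ci)%C) by (intros s; ring).
refine (Rder_ext _ _ _ _ _ _ _ H); unfold cis; [intros s|]; rewrite E; reflexivity.
Qed.

Lemma cis_cont (k t : R) : continuous (U := CU) (cis k) t.
Proof. exact (Rder_cont _ _ _ (Rder_cis k t)). Qed.

Lemma Cmod_cis (k t : R) : Cmod (cis k t) = 1.
Proof.
unfold cis; rewrite Cmod_cexp; replace (Re (k * t * Ci)%C) with 0; [apply exp_0|].
simpl; ring.
Qed.

Lemma cis_plus (k l t : R) : (cis k t * cis l t = cis (k + l) t)%C.
Proof. unfold cis; rewrite <- cexp_plus, RtoC_plus; f_equal; ring. Qed.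

Lemma cis_0 (t : R) : cis 0 t = 1.
Proof. unfold cis; rewrite <- cexp_0; f_equal; ring. Qed.

Lemma cis_at_0 (k : R) : cis k 0 = 1.
Proof. unfold cis; rewrite <- cexp_0; f_equal; ring. Qed.

Lemma cis_2PI_nat (k : nat) : cis (INR k) (2 * PI) = 1.
Proof.
unfold cis.
replace (INR k * (2 * PI)%R * Ci)%C with (INR k * (2 * PI * Ci))%C by (rewrite RtoC_mult; ring).
rewrite <- cexp_pow, cexp_periodic; apply Cpow_1_l.
Qed.

Lemma cis_2PI_opp (k : nat) : cis (- INR k) (2 * PI) = 1.
Proof.
assert (H := cis_plus (INR k) (- INR k) (2 * PI)).
rewrite Rplus_opp_r, cis_0, cis_2PI_nat, Cmult_1_l in H; exact H.
Qed.

(* [2 * PI * zeta ^ k / k!] times the [k]-th derivative of [f] at [z]. *)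
Definition circle_coeff (k : nat) (f : C -> C) (z zeta : C) : C :=
  CInt (fun t => f (z + zeta * cis 1 t) * cis (- INR k) t)%C 0 (2 * PI).

Lemma two_PI_pos : 0 < 2 * PI.
Proof. generalize PI_RGT_0; lra. Qed.

Lemma circle_in_ball (z w zeta : C) (t R0 : R) :
  Cmod (w - z) + Cmod zeta < R0 -> Cball z R0 (w + zeta * cis 1 t).
Proof.
intros H; unfold Cball.
replace (w + zeta * cis 1 t - z)%C with ((w - z) + zeta * cis 1 t)%C by ring.
eapply Rle_lt_trans; [apply Cmod_triangle|].
rewrite Cmod_mult, Cmod_cis; lra.
Qed.

Section Circle.
Variables (f f' : C -> C) (z0 : C) (R0 : R).
Hypothesis Hf : C1_on (Cball z0 R0) f f'.

Lemma circle_coeff_correct (k : nat) (g : C -> C) (z zeta : C) :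
  (forall w, Cball z0 R0 w -> continuous (T := CU) (U := CU) g w) ->
  Cmod (z - z0) + Cmod zeta < R0 ->
  is_CInt (fun t => g (z + zeta * cis 1 t) * cis (- INR k) t)%C 0 (2 * PI) (circle_coeff k g z zeta).
Proof.
intros Hg H; apply CInt_correct; [apply Rlt_le, two_PI_pos|]; intros t _.
apply cont_mult; [|apply cis_cont].
refine (@continuous_comp R_UniformSpace CU CU (fun t => z + zeta * cis 1 t)%C g t _ _).
- apply cont_plus; [apply cont_const|]; apply cont_mult; [apply cont_const|apply cis_cont].
- apply Hg, circle_in_ball, H.
Qed.

Lemma Cder_circle_coeff_center (k : nat) (z zeta : C) :
  Cmod (z - z0) + Cmod zeta < R0 ->
  Cder (fun w => circle_coeff k f w zeta) z (circle_coeff k f' z zeta).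
Proof.
intros H.
assert (A := Cder_CInt_affine f f' (fun t => zeta * cis 1 t)%C (fun _ => RtoC 1) (cis (- INR k)) 0 (2 * PI)
  z (R0 - Cmod zeta - Cmod (z - z0)) (Rlt_le _ _ two_PI_pos)).
assert (E : forall (g : C -> C) w t,
  g (zeta * cis 1 t + w * 1)%C = g (w + zeta * cis 1 t)%C) by (intros; f_equal; ring).
apply (is_derive_ext (K := C_AbsRing) (V := C_NormedModule)
  (fun w => CInt (fun t => f (zeta * cis 1 t + w * 1) * cis (- INR k) t)%C 0 (2 * PI))).
{ intros w; apply (RInt_ext (V := C_R_CompleteNormedModule)); intros t _; rewrite E; reflexivity. }
apply (Cder_eq _ _ (CInt (fun t => 1 * f' (zeta * cis 1 t + z * 1) * cis (- INR k) t)%C 0 (2 * PI))).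
{ apply (RInt_ext (V := C_R_CompleteNormedModule)); intros t _; rewrite E, Cmult_1_l; reflexivity. }
apply A.
- lra.
- intros t; apply cont_mult; [apply cont_const|apply cis_cont].
- intros t; apply cont_const.
- intros t; apply cis_cont.
- intros w t Hw _.
  assert (E' : (zeta * cis 1 t + w * 1 = w + zeta * cis 1 t)%C) by ring.
  rewrite E'; apply Hf, circle_in_ball.
  (* Discs are open, so the slack left over is shared equally by the two radii; their sum is
     [R0 - Cmod zeta]. *)
  assert (T := Cball_trans z0 z w (Cmod (z - z0) + (R0 - Cmod zeta - Cmod (z - z0) - Cmod (w - z)) / 2)
    (Cmod (w - z) + (R0 - Cmod zeta - Cmod (z - z0) - Cmod (w - z)) / 2)).
  unfold Cball in T, Hw; specialize (T ltac:(lra) ltac:(lra)); lra.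
Qed.

(** Differentiating in the complex radius produces a factor e^(it), which lowers the frequency from
    k + 1 to k. *)
Lemma Cder_circle_coeff_radius (k : nat) (zeta : C) :
  Cmod zeta < R0 ->
  Cder (fun w => circle_coeff (S k) f z0 w) zeta (circle_coeff k f' z0 zeta).
Proof.
intros H.
apply (Cder_eq _ _ (CInt (fun t => cis 1 t * f' (z0 + zeta * cis 1 t) * cis (- INR (S k)) t)%C 0 (2 * PI))).
{ apply (RInt_ext (V := C_R_CompleteNormedModule)); intros t _.
  replace (- INR k) with (1 + - INR (S k)) by (rewrite S_INR; ring).
  rewrite <- cis_plus; simpl; ring. }
apply (Cder_CInt_affine f f' (fun _ => z0) (cis 1) (cis (- INR (S k))) 0 (2 * PI)
  zeta (R0 - Cmod zeta) (Rlt_le _ _ two_PI_pos)).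
- lra.
- intros t; apply cont_const.
- intros t; apply cis_cont.
- intros t; apply cis_cont.
- intros w t Hw _; apply Hf, circle_in_ball.
  replace (z0 - z0)%C with (RtoC 0) by ring; rewrite Cmod_0.
  assert (T := Cmod_triangle (w - zeta) zeta).
  replace (w - zeta + zeta)%C with w in T by ring; unfold Cball in Hw; lra.
Qed.

(** The function f(z + zeta e^(it)) e^(-i(k+1)t) has period 2 pi, so its derivative in t integrates
    to 0 over [0, 2 pi]. The two terms of that derivative are the two sides, up to the factor i. *)
Lemma circle_coeff_by_parts (k : nat) (z zeta : C) :
  Cmod (z - z0) + Cmod zeta < R0 ->
  (zeta * circle_coeff k f' z zeta = INR (S k) * circle_coeff (S k) f z zeta)%C.
Proof.
intros H.
assert (I1 := circle_coeff_correct k f' z zeta (fun w Hw => proj2 (Hf w Hw)) H).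
assert (I2 := circle_coeff_correct (S k) f z zeta (fun w Hw => Cder_cont _ _ _ (proj1 (Hf w Hw))) H).
assert (I := is_CInt_minus _ _ _ _ _ _ (is_CInt_scal (zeta * Ci) _ _ _ _ I1)
  (is_CInt_scal (INR (S k) * Ci) _ _ _ _ I2)).
assert (F := is_CInt_derive (fun t => f (z + zeta * cis 1 t) * cis (- INR (S k)) t)%C
  (fun t => zeta * Ci * (f' (z + zeta * cis 1 t) * cis (- INR k) t) -
    INR (S k) * Ci * (f (z + zeta * cis 1 t) * cis (- INR (S k)) t))%C
  0 (2 * PI) (Rlt_le _ _ two_PI_pos)).
assert (P : forall t, Rder (fun t => z + zeta * cis 1 t)%C t (zeta * (1 * (Ci * cis 1 t)))%C).
{ intros t; refine (Rder_ext _ _ _ _ _ _ _ (Rder_comp (fun w => z + zeta * w)%C (cis 1) t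
    (0 + zeta * 1)%C _ _ (Rder_cis 1 t))); [reflexivity|ring|].
  apply Cder_plus; [apply Cder_const|]; apply Cder_scal, Cder_id. }
lapply F; clear F; [intros F; lapply F; clear F; [intros F|]|].
- assert (E : (zeta * Ci * circle_coeff k f' z zeta - INR (S k) * Ci * circle_coeff (S k) f z zeta = 0)%C).
  { rewrite <- (is_CInt_unique _ _ _ _ I), (is_CInt_unique _ _ _ _ F).
    change 1 with (INR 1); rewrite cis_2PI_nat, cis_2PI_opp, !cis_at_0; ring. }
  apply Ceq_minus.
  replace (zeta * circle_coeff k f' z zeta - INR (S k) * circle_coeff (S k) f z zeta)%C with
    (/ Ci * (zeta * Ci * circle_coeff k f' z zeta - INR (S k) * Ci * circle_coeff (S k) f z zeta))%C
    by (field; exact Ci_nz).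
  rewrite E; ring.
- intros t _; apply cont_minus; (apply cont_mult; [apply cont_const|]); (apply cont_mult; [|apply cis_cont]);
    (refine (@continuous_comp R_UniformSpace CU CU (fun t => z + zeta * cis 1 t)%C _ t (Rder_cont _ _ _ (P t)) _)).
  + apply Hf, circle_in_ball, H.
  + apply (Cder_cont _ _ _ (proj1 (Hf _ (circle_in_ball z0 z zeta t R0 H)))).
- intros t _.
  refine (Rder_ext _ _ _ _ _ _ _ (Rder_mult _ _ _ _ _
    (Rder_comp f _ t _ _ (proj1 (Hf _ (circle_in_ball z0 z zeta t R0 H))) (P t))
    (Rder_cis (- INR (S k)) t))); [reflexivity|].
  replace (- INR k) with (1 + - INR (S k)) by (rewrite S_INR; ring).
  rewrite <- cis_plus, RtoC_opp; ring.
Qed.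

End Circle.

Lemma C1_on_mono (D D' : C -> Prop) (f f' : C -> C) :
  (forall z, D' z -> D z) -> C1_on D f f' -> C1_on D' f f'.
Proof. intros H Hf z Hz; apply Hf, H, Hz. Qed.

Lemma circle_coeff_0 (f : C -> C) (z : C) :
  circle_coeff 0 f z 0 = (2 * PI * f z)%C.
Proof.
unfold circle_coeff; apply is_CInt_unique.
assert (H := is_RInt_const (V := C_R_NormedModule) 0 (2 * PI) (f z)).
apply (is_RInt_ext (V := C_R_NormedModule) (fun _ => f z)).
2:{ refine (eq_ind _ (is_CInt (fun _ => f z) 0 (2 * PI)) H _ _).
  etransitivity; [apply scal_R_Cmult|]; rewrite Rminus_0_r, RtoC_mult; reflexivity. }
intros t _; simpl; rewrite Ropp_0, cis_0, Cmult_1_r, Cmult_0_l, Cplus_0_r; reflexivity.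
Qed.

Lemma cauchy_derivative (f f' : C -> C) (z : C) (R0 r : R) :
  C1_on (Cball z R0) f f' -> 0 < r < R0 ->
  circle_coeff 1 f z r = (2 * PI * r * f' z)%C.
Proof.
(* [phi := circle_coeff 1 f z] satisfies [x * phi' x = phi x], so [phi x / x] does not depend on [x > 0]. *)
intros Hf Hr.
set (phi := circle_coeff 1 f z). set (dphi := circle_coeff 0 f' z).
assert (Hd : forall x, Cmod x < R0 -> Cder phi x (dphi x)).
{ intros x Hx; exact (Cder_circle_coeff_radius f f' z R0 Hf 0 x Hx). }
assert (Hp : forall x, Cmod x < R0 -> (x * dphi x = phi x)%C).
{ intros x Hx; generalize (circle_coeff_by_parts f f' z R0 Hf 0 z x).
  replace (z - z)%C with (RtoC 0) by ring; rewrite Cmod_0, Rplus_0_l; simpl INR; rewrite Cmult_1_l.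
  intros H; apply H, Hx. }
assert (H0 : dphi 0 = (2 * PI * f' z)%C).
{ apply circle_coeff_0. }
assert (Hq : forall rho, 0 < rho <= r -> (phi r / r = phi rho / rho)%C).
{ intros rho Hrho; apply Ceq_minus.
  assert (Hm := Rder_mean_value (fun x => phi x * / x)%C (fun _ => RtoC 0) rho r 0 (proj2 Hrho)).
  apply Cmod_eq_0, Rle_antisym; [|apply Cmod_ge_0].
  rewrite Rmult_0_l in Hm; apply Hm; [|intros; rewrite Cmod_0; lra].
  intros x Hx.
  assert (Hx0 : RtoC x <> 0) by (intros E; apply RtoC_inj in E; lra).
  assert (HxR : Cmod x < R0) by (rewrite Cmod_R, Rabs_pos_eq; lra).
  assert (HL := Rder_line 0 1 x).
  assert (E : forall s : R, (0 + s * 1 = s)%C) by (intros; ring).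
  assert (K := Cder_mult _ _ _ _ _ (Hd x HxR) (Cder_inv x Hx0)).
  rewrite <- (Hp x HxR) in K.
  rewrite <- (E x) in K.
  refine (Rder_ext _ _ _ _ _ _ _ (Rder_comp _ _ _ _ _ K HL)).
  - intros s; simpl; rewrite E; reflexivity.
  - simpl; rewrite E; field; exact Hx0. }
assert (Hr0 : RtoC r <> 0) by (intros E; apply RtoC_inj in E; lra).
(* Since phi 0 = 0, the constant quotient is identified by letting rho tend to 0: it is the
   derivative of [phi] at 0. *)
assert (Hlim : (phi r / r - dphi 0 = 0)%C).
{ apply Cmod_eq_0, Rle_antisym; [|apply Cmod_ge_0].
  apply le_epsilon; intros eps He; rewrite Rplus_0_l.
  destruct (proj1 (Cder_eps _ _ _) (Hd 0 ltac:(rewrite Cmod_0; lra)) eps He) as [d [Hd1 Hd2]].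
  set (rho := Rmin (d / 2) r).
  assert (Hrho : 0 < rho) by (apply Rmin_pos; lra).
  assert (Hrho0 : RtoC rho <> 0) by (intros E; apply RtoC_inj in E; lra).
  assert (M1 := Rmin_l (d / 2) r); assert (M2 := Rmin_r (d / 2) r); fold rho in M1, M2.
  rewrite (Hq rho) by lra.
  specialize (Hd2 rho); replace (rho - 0)%C with (RtoC rho) in Hd2 by ring.
  rewrite Cmod_R, Rabs_pos_eq in Hd2 by lra; specialize (Hd2 ltac:(lra)).
  assert (E0 : phi 0 = 0) by (rewrite <- Hp by (rewrite Cmod_0; lra); ring).
  rewrite E0 in Hd2.
  replace (phi rho / rho - dphi 0)%C with (/ rho * (phi rho - 0 - rho * dphi 0))%C by (field; exact Hrho0).
  rewrite Cmod_mult, Cmod_inv, Cmod_R, Rabs_pos_eq by (try assumption; lra).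
  apply (Rmult_le_reg_l rho); [exact Hrho|].
  rewrite <- Rmult_assoc, Rinv_r, Rmult_1_l by lra; lra. }
apply Ceq_minus in Hlim; rewrite H0 in Hlim.
replace (phi r) with (r * (phi r / r))%C by (field; exact Hr0).
rewrite Hlim; ring.
Qed.

Lemma cauchy_estimate (f f' : C -> C) (z : C) (R0 r M : R) :
  C1_on (Cball z R0) f f' -> 0 < r < R0 ->
  (forall w, Cball z R0 w -> Cmod (f w) <= M) -> Cmod (f' z) <= M / r.
Proof.
intros Hf Hr HM.
assert (H := cauchy_derivative f f' z R0 r Hf Hr).
assert (HB : Cmod (z - z) + Cmod r < R0).
{ replace (z - z)%C with (RtoC 0) by ring; rewrite Cmod_0, Cmod_R, Rabs_pos_eq; lra. }
assert (I := circle_coeff_correct z R0 1 f z r (fun w Hw => Cder_cont _ _ _ (proj1 (Hf w Hw))) HB).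
assert (N : Cmod (circle_coeff 1 f z r) <= (2 * PI - 0) * M).
{ refine (is_CInt_norm_le _ _ _ M _ (Rlt_le _ _ two_PI_pos) _ I); intros t _; cbv beta.
  rewrite Cmod_mult, Cmod_cis, Rmult_1_r; apply HM, circle_in_ball, HB. }
rewrite H, !Cmod_mult, !Cmod_R, (Rabs_pos_eq r), (Rabs_pos_eq 2), (Rabs_pos_eq PI), Rminus_0_r in N
  by (generalize PI_RGT_0; lra).
rewrite Rmult_assoc in N; apply Rmult_le_reg_l in N; [|exact two_PI_pos].
apply (Rmult_le_reg_l r); [lra|]; replace (r * (M / r)) with M by (field; lra); exact N.
Qed.

(** Near z, Cauchy's formula writes f' as a circle integral of f, and differentiating in the centre
    gives f'' as a circle integral of f'. Integration by parts turns this into a circle integral of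
    f again, which is differentiable in the centre and hence continuous. *)
Lemma C1_on_derivative (D : C -> Prop) (f f' : C -> C) :
  Copen D -> C1_on D f f' -> exists f'', C1_on D f' f''.
Proof.
intros HD Hf; exists (C_derive f'); intros z Hz.
destruct (HD z Hz) as [R0 [HR0 HR]].
assert (Hf' : C1_on (Cball z R0) f f') by (intros w Hw; apply Hf, HR, Hw).
(* For w within r of z, the disc of radius 2r about w lies in the disc of radius R0 about z, and
   Cauchy's formula is used in it on the circle of radius r. *)
set (r := R0 / 3).
assert (Hr : 0 < r) by (unfold r; lra).
assert (Hr0 : RtoC r <> 0) by (intros E; apply RtoC_inj in E; lra).
assert (HPI : RtoC PI <> 0) by (intros E; apply RtoC_inj in E; generalize PI_RGT_0; lra).
assert (H2 : RtoC 2 <> 0) by (intros E; apply RtoC_inj in E; lra).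
assert (HB : forall w, Cball z r w -> Cmod (w - z) + Cmod r < R0).
{ unfold Cball; intros w Hw; rewrite Cmod_R, Rabs_pos_eq; unfold r in *; lra. }
assert (F1 : forall w, Cball z r w -> f' w = (/ (2 * PI * r) * circle_coeff 1 f w r)%C).
{ intros w Hw; rewrite (cauchy_derivative f f' w (2 * r) r).
  - field; auto.
  - intros v Hv; apply Hf'; replace R0 with (r + 2 * r) by (unfold r; field).
    exact (Cball_trans z w v _ _ Hw Hv).
  - lra. }
assert (F2 : forall w, Cball z r w -> Cder f' w (/ (2 * PI * r) * circle_coeff 1 f' w r)%C).
{ intros w Hw.
  destruct (Copen_Cball z r w Hw) as [s [Hs Hs']].
  refine (Cder_ext_ball _ _ _ _ s Hs _ (Cder_scal _ _ _ _ (Cder_circle_coeff_center f f' z R0 Hf' 1 w r (HB w Hw)))).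
  intros v Hv; symmetry; apply F1, Hs', Hv. }
assert (F3 : forall w, Cball z r w -> C_derive f' w = (/ (PI * r * r) * circle_coeff 2 f w r)%C).
{ intros w Hw; rewrite (is_C_derive_unique _ _ _ (F2 w Hw)).
  assert (P := circle_coeff_by_parts f f' z R0 Hf' 1 w r (HB w Hw)).
  change (INR 2) with 2 in P.
  replace (circle_coeff 2 f w r) with (/ 2 * (2 * circle_coeff 2 f w r))%C by (field; auto).
  rewrite <- P; field; auto. }
assert (Hz0 : Cball z r z) by (apply Cball_center, Hr).
split.
- rewrite (is_C_derive_unique _ _ _ (F2 z Hz0)); apply F2, Hz0.
- apply (Cder_cont _ _ (/ (PI * r * r) * circle_coeff 2 f' z r)%C).
  refine (Cder_ext_ball _ _ _ _ r Hr _ (Cder_scal _ _ _ _ (Cder_circle_coeff_center f f' z R0 Hf' 2 z r (HB z Hz0)))).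
  intros v Hv; symmetry; apply F3, Hv.
Qed.

(** * Primitives, square roots and roots on a disc *)

(** The primitive is (w - z0) times the integral of f(z0 + t (w - z0)) over t in [0, 1]. Its
    derivative is the integral of d/dt [t f(z0 + t (w - z0))], which is f(w). *)
Lemma primitive_on_ball (z0 : C) (R0 : R) (f f' : C -> C) :
  C1_on (Cball z0 R0) f f' -> exists F, C1_on (Cball z0 R0) F f.
Proof.
intros Hf.
set (A := fun t : R => (z0 - t * z0)%C). set (B := fun t : R => (0 + t * 1)%C).
assert (HA : forall t, continuous (U := CU) A t).
{ intros t; apply (@continuous_ext R_UniformSpace CU (fun t : R => z0 + t * (- z0))%C A t); [intros s; unfold A; change (z0 + s * - z0 = z0 - s * z0)%C; ring|].
  exact (Rder_cont _ _ _ (Rder_line z0 (- z0) t)). }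
assert (HB : forall t, continuous (U := CU) B t) by (intros t; exact (Rder_cont _ _ _ (Rder_line 0 1 t))).
assert (EAB : forall w t, (A t + w * B t = z0 + t * (w - z0))%C) by (intros; unfold A, B; ring).
assert (Hin : forall w t, Cball z0 R0 w -> 0 <= t <= 1 -> Cball z0 R0 (z0 + t * (w - z0))%C).
{ intros w t Hw Ht; unfold Cball; apply segment_ball; [|exact Hw|exact Ht].
  apply Cball_center; unfold Cball in Hw; generalize (Cmod_ge_0 (w - z0)); lra. }
exists (fun w => (w - z0) * CInt (fun t => f (A t + w * B t) * 1)%C 0 1)%C.
intros z Hz; split; [|exact (Cder_cont _ _ _ (proj1 (Hf z Hz)))].
destruct (Copen_Cball z0 R0 z Hz) as [r [Hr HrR]].
assert (HJ : Cder (fun w => CInt (fun t => f (A t + w * B t) * 1)%C 0 1) z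
  (CInt (fun t => B t * f' (A t + z * B t) * 1)%C 0 1)).
{ apply (Cder_CInt_affine f f' A B (fun _ => RtoC 1) 0 1 z r Rle_0_1 Hr HA HB).
  - intros t; apply cont_const.
  - intros w t Hw Ht; rewrite EAB; apply Hf, Hin; [apply HrR, Hw|exact Ht]. }
refine (Cder_eq _ _ _ _ _ (Cder_mult _ _ _ _ _ (Cder_minus _ _ _ _ _ (Cder_id z) (Cder_const z0 z)) HJ)).
assert (HL : forall t, continuous (U := CU) (fun t => A t + z * B t)%C t).
{ intros t; apply cont_plus; [apply HA|]; apply cont_mult; [apply cont_const|apply HB]. }
assert (Hd : forall t, 0 <= t <= 1 -> Cder f (A t + z * B t)%C (f' (A t + z * B t)%C) /\
  continuous (T := CU) (U := CU) f' (A t + z * B t)%C).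
{ intros t Ht; rewrite EAB; apply Hf, Hin; assumption. }
assert (C1 : forall t, 0 <= t <= 1 -> continuous (U := CU) (fun t => f (A t + z * B t) * 1)%C t).
{ intros t Ht; apply cont_mult; [|apply cont_const].
  refine (@continuous_comp R_UniformSpace CU CU (fun t => A t + z * B t)%C f t (HL t) _).
  exact (Cder_cont _ _ _ (proj1 (Hd t Ht))). }
assert (C2 : forall t, 0 <= t <= 1 -> continuous (U := CU) (fun t => B t * f' (A t + z * B t) * 1)%C t).
{ intros t Ht; apply cont_mult; [|apply cont_const]; apply cont_mult; [apply HB|].
  exact (@continuous_comp R_UniformSpace CU CU (fun t => A t + z * B t)%C f' t (HL t) (proj2 (Hd t Ht))). }
assert (I := is_CInt_plus _ _ _ _ _ _ (CInt_correct _ 0 1 Rle_0_1 C1)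
  (is_CInt_scal (z - z0) _ _ _ _ (CInt_correct _ 0 1 Rle_0_1 C2))).
assert (J := is_CInt_derive (fun t => B t * f (z0 + t * (z - z0)))%C
  (fun t => f (A t + z * B t) * 1 + (z - z0) * (B t * f' (A t + z * B t) * 1))%C 0 1 Rle_0_1).
lapply J; clear J; [intros J; lapply J; clear J; [intros J|]|].
- assert (E := is_CInt_unique _ _ _ _ J); rewrite (is_CInt_unique _ _ _ _ I) in E.
  transitivity (B 1 * f (z0 + 1 * (z - z0)) - B 0 * f (z0 + 0 * (z - z0)))%C.
  + rewrite <- E; change (UniformSpace.sort R_UniformSpace) with R; ring.
  + replace (z0 + 1 * (z - z0))%C with z by ring; unfold B; ring.
- intros t Ht; apply cont_plus; [apply C1, Ht|]; apply cont_mult; [apply cont_const|apply C2, Ht].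
- intros t Ht.
  assert (Hd' := proj1 (Hd t Ht)); rewrite EAB in Hd' |- *.
  refine (Rder_ext _ _ _ _ _ _ _ (Rder_mult _ _ _ _ _ (Rder_line 0 1 t)
    (Rder_comp f (fun s => z0 + s * (z - z0))%C t _ _ Hd' (Rder_line z0 (z - z0) t)))); [reflexivity|].
  unfold B; ring.
Qed.

Lemma C1_on_comp (D E : C -> Prop) (f f' g g' : C -> C) :
  C1_on E g g' -> C1_on D f f' -> (forall z, D z -> E (f z)) ->
  C1_on D (fun z => g (f z)) (fun z => f' z * g' (f z))%C.
Proof.
intros Hg Hf HE z Hz; destruct (Hf z Hz) as [H1 H2]; destruct (Hg _ (HE z Hz)) as [H3 H4]; split.
- exact (Cder_comp g f z _ _ H3 H1).
- apply (@cont_mult CU); [exact H2|].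
  exact (@continuous_comp CU CU CU f g' z (Cder_cont _ _ _ H1) H4).
Qed.

Lemma C1_on_mult (D : C -> Prop) (f f' g g' : C -> C) :
  C1_on D f f' -> C1_on D g g' ->
  C1_on D (fun z => f z * g z)%C (fun z => f' z * g z + f z * g' z)%C.
Proof.
intros Hf Hg z Hz; destruct (Hf z Hz) as [H1 H2]; destruct (Hg z Hz) as [H3 H4]; split.
- exact (Cder_mult _ _ _ _ _ H1 H3).
- apply Cder_cont in H1; apply Cder_cont in H3.
  apply (@cont_plus CU); apply (@cont_mult CU); assumption.
Qed.

Lemma C1_on_Cinv : C1_on (fun z => z <> 0) Cinv (fun z => - / (z * z))%C.
Proof.
intros z Hz; split; [exact (Cder_inv z Hz)|].
apply (continuous_ext_loc (T := CU) (U := CU) _ (fun z => (0 - Cinv z * Cinv z)%C)).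
- exists (mkposreal (Cmod z) (proj1 (Cmod_gt_0 z) Hz)); intros w Hw.
  assert (Hw' : Cmod (w - z) < Cmod z) by exact Hw.
  assert (Hw0 : (w : C) <> 0).
  { intros E; rewrite E in Hw'; replace (0 - z)%C with (- z)%C in Hw' by ring; rewrite Cmod_opp in Hw'; lra. }
  change (0 - / w * / w = - / (w * w))%C; field; exact Hw0.
- apply (@cont_minus CU); [apply (@cont_const CU)|].
  apply (@cont_mult CU); exact (Cder_cont _ _ _ (Cder_inv z Hz)).
Qed.

Lemma C1_on_cexp (D : C -> Prop) : C1_on D cexp cexp.
Proof. intros z _; split; [apply Cder_cexp|exact (Cder_cont _ _ _ (Cder_cexp z))]. Qed.

Lemma C1_on_const (D : C -> Prop) (c : C) : C1_on D (fun _ => c) (fun _ => RtoC 0).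
Proof. intros z _; split; [apply Cder_const|apply (@cont_const CU)]. Qed.

(** With m = |c|, the root has real part sqrt((m + x)/2) and imaginary part sqrt((m - x)/2) up to
    sign, and the sign is that of y. *)
Lemma Csqrt_exists (c : C) : exists k : C, (k * k)%C = c.
Proof.
destruct c as [x y].
set (m := Cmod (x, y)).
assert (Hm : m * m = x * x + y * y).
{ unfold m, Cmod; simpl fst; simpl snd; rewrite sqrt_sqrt; [ring|nra]. }
assert (Hx := re_le_Cmod (x, y)); fold m in Hx; simpl in Hx; apply Rabs_le_between in Hx.
set (a := sqrt ((m + x) / 2)). set (b := sqrt ((m - x) / 2)).
assert (Ha : a * a = (m + x) / 2) by (apply sqrt_sqrt; lra).
assert (Hb : b * b = (m - x) / 2) by (apply sqrt_sqrt; lra).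
assert (Hab : 2 * (a * b) = Rabs y).
{ unfold a, b; rewrite <- sqrt_mult by lra.
  replace ((m + x) / 2 * ((m - x) / 2)) with (Rsqr (y / 2)).
  - rewrite sqrt_Rsqr_abs; unfold Rdiv; rewrite Rabs_mult, (Rabs_pos_eq (/ 2)) by lra; field.
  - unfold Rsqr; field_simplify; replace (m ^ 2) with (m * m) by ring; rewrite Hm; field. }
destruct (Rle_lt_dec 0 y) as [Hy|Hy].
- rewrite Rabs_pos_eq in Hab by assumption.
  exists (a, b); unfold Cmult; simpl; f_equal; lra.
- rewrite Rabs_left in Hab by assumption.
  exists (a, - b); unfold Cmult; simpl; f_equal; lra.
Qed.

Section Sqrt.
Variable D : C -> Prop.
Hypothesis primitive : forall f f', C1_on D f f' -> exists F, C1_on D F f.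
Hypothesis derivative_zero :
  forall f, (forall z, D z -> Cder f z (RtoC 0)) -> forall z w, D z -> D w -> f z = f w.
Hypothesis D_open : Copen D.

(** If L is a primitive of h'/h, then h e^(-L) has derivative 0 and is a constant c; a root is k
    e^(L/2) with k^2 = c. Stated from the section hypotheses, the argument serves both for discs and
    for the domain [U]. *)
Lemma holomorphic_sqrt (h h' : C -> C) :
  C1_on D h h' -> (forall z, D z -> h z <> 0) ->
  exists g g', C1_on D g g' /\ forall z, D z -> (g z * g z)%C = h z.
Proof.
intros Hh Hh0.
(* A base point is needed to define the constant [c]; on an empty [D] any function will do. *)
destruct (classic (exists a, D a)) as [[a Ha]|Hemp].
2:{ exists h, h'; split; [exact Hh|]; intros z Hz; destruct Hemp; exists z; exact Hz. }
destruct (C1_on_derivative D h h' D_open Hh) as [h'' Hh'].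
assert (Hi := C1_on_comp D _ _ _ _ _ C1_on_Cinv Hh Hh0).
destruct (primitive _ _ (C1_on_mult _ _ _ _ _ Hh' Hi)) as [L HL].
set (c := (h a * cexp (- L a))%C).
assert (Hc : forall z, D z -> h z = (c * cexp (L z))%C).
{ intros z Hz.
  assert (E : (h z * cexp (- L z))%C = c).
  { refine (derivative_zero (fun z => h z * cexp (- L z))%C _ z a Hz Ha).
    intros w Hw.
    assert (HN : Cder (fun w => - L w)%C w (0 - h' w * / h w)%C).
    { refine (Cder_ext_ball _ _ _ _ 1 Rlt_0_1 _
        (Cder_minus _ _ _ _ _ (Cder_const 0 w) (proj1 (HL w Hw)))); intros; ring. }
    refine (Cder_eq _ _ _ _ _ (Cder_mult _ _ _ _ _ (proj1 (Hh w Hw))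
      (Cder_comp cexp (fun w => - L w)%C w _ _ (Cder_cexp _) HN))).
    field; apply Hh0, Hw. }
  rewrite <- E.
  transitivity (h z * (cexp (L z) * cexp (- L z)))%C; [rewrite cexp_opp|]; ring. }
destruct (Csqrt_exists c) as [k Hk].
assert (H2 : RtoC 2 <> 0) by (intros E; apply RtoC_inj in E; lra).
assert (HL2 := C1_on_mult _ _ _ _ _ (C1_on_const D (/ 2)%C) HL).
assert (Hg := C1_on_mult _ _ _ _ _ (C1_on_const D k)
  (C1_on_comp D _ _ _ _ _ (C1_on_cexp (fun _ => True)) HL2 (fun _ _ => I))).
eexists; eexists; split; [exact Hg|].
intros z Hz; simpl; rewrite (Hc z Hz), <- Hk.
replace (L z) with (/ 2 * L z + / 2 * L z)%C at 3 by (field; exact H2).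
rewrite cexp_plus; ring.
Qed.

(** Iterating square roots is enough, which is why the order is a power of two. *)
Lemma holomorphic_root (j : nat) (h h' : C -> C) :
  C1_on D h h' -> (forall z, D z -> h z <> 0) ->
  exists g g', C1_on D g g' /\ forall z, D z -> h z = (g z ^ (2 ^ j))%C.
Proof.
revert h h'; induction j as [|j IH]; intros h h' Hh Hh0.
- exists h, h'; split; [exact Hh|]; intros z Hz; simpl; ring.
- destruct (holomorphic_sqrt h h' Hh Hh0) as [g [g' [Hg Hgh]]].
  destruct (IH g g' Hg) as [k [k' [Hk Hkg]]].
  { intros z Hz E; apply (Hh0 z Hz); rewrite <- (Hgh z Hz), E; ring. }
  exists k, k'; split; [exact Hk|]; intros z Hz.
  rewrite <- (Hgh z Hz), (Hkg z Hz); simpl; rewrite Nat.add_0_r, Cpow_add_r; reflexivity.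
Qed.
End Sqrt.

Lemma derivative_zero_on_ball (z0 : C) (R0 : R) (f : C -> C) :
  (forall z, Cball z0 R0 z -> Cder f z (RtoC 0)) ->
  forall z w, Cball z0 R0 z -> Cball z0 R0 w -> f z = f w.
Proof.
intros Hf z w Hz Hw; symmetry; apply Ceq_minus, Cmod_eq_0, Rle_antisym; [|apply Cmod_ge_0].
rewrite <- (Rmult_0_l (Cmod (w - z))).
apply (Cder_mean_value f (fun _ => RtoC 0) z0 R0); try assumption.
intros; rewrite Cmod_0; lra.
Qed.

Lemma pow_le_reg (a b : R) (n : nat) : 0 <= b -> n <> 0%nat -> a ^ n <= b ^ n -> a <= b.
Proof.
intros Hb Hn H; apply Rnot_lt_le; intros Hlt; apply (Rle_not_lt _ _ H).
assert (Hp : forall m, b ^ S m < a ^ S m).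
{ intros m; induction m as [|m IH]; [simpl; lra|].
  change (b * b ^ S m < a * a ^ S m); apply Rmult_le_0_lt_compat; try assumption.
  apply pow_le; exact Hb. }
destruct n as [|n]; [contradiction|apply Hp].
Qed.

Lemma small_value_spreads (z0 : C) (R0 : R) (h h' : C -> C) (j : nat) (w : C) :
  C1_on (Cball z0 R0) h h' -> (forall z, Cball z0 R0 z -> h z <> 0) ->
  (forall z, Cball z0 R0 z -> Cmod (h z) <= 1) ->
  Cball z0 (R0 / 4) w ->
  Cmod (h z0) <= (1 / 4) ^ (2 ^ j) -> Cmod (h w) <= (3 / 4) ^ (2 ^ j).
Proof.
(* The root [g] of order [2 ^ j] is bounded by 1, hence is [2 / R0]-Lipschitz near [z0]. *)
intros Hh Hn H1 Hw H0.
assert (HR : 0 < R0) by (unfold Cball in Hw; generalize (Cmod_ge_0 (w - z0)); lra).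
assert (N2 : (2 ^ j <> 0)%nat) by (apply Nat.pow_nonzero; lia).
destruct (holomorphic_root (Cball z0 R0) (primitive_on_ball z0 R0) (derivative_zero_on_ball z0 R0)
  (Copen_Cball z0 R0) j h h' Hh Hn) as [g [g' [Hg Hgh]]].
assert (Hz0 : Cball z0 R0 z0) by (apply Cball_center, HR).
assert (Hw0 : Cball z0 R0 w) by (unfold Cball in *; lra).
assert (Hg1 : forall z, Cball z0 R0 z -> Cmod (g z) <= 1).
{ intros z Hz; apply (pow_le_reg _ _ (2 ^ j)); [lra|exact N2|].
  rewrite pow1, <- Cmod_pow, <- Hgh by exact Hz; apply H1, Hz. }
assert (HL : Cmod (g w - g z0) <= 1 / (R0 / 2) * Cmod (w - z0)).
{ apply (Cder_mean_value g g' z0 (R0 / 4)).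
  - intros z Hz; apply Hg; unfold Cball; lra.
  - intros z Hz.
    (* Cauchy's estimate at radius R0/2 inside this disc gives |g'| <= 2/R0 on the quarter disc. So
       g varies by at most 1/2 from its centre value, which is at most 1/4 in modulus. *)
    assert (Hs : forall v, Cball z (3 / 4 * R0) v -> Cball z0 R0 v).
    { intros v Hv; replace R0 with (R0 / 4 + 3 / 4 * R0) by field; exact (Cball_trans z0 z v _ _ Hz Hv). }
    apply (cauchy_estimate g g' z (3 / 4 * R0)); [|lra|intros v Hv; apply Hg1, Hs, Hv].
    exact (C1_on_mono _ _ _ _ Hs Hg).
  - apply Cball_center; lra.
  - exact Hw. }
assert (Hg0 : Cmod (g z0) <= 1 / 4).
{ apply (pow_le_reg _ _ (2 ^ j)); [lra|exact N2|]; rewrite <- Cmod_pow, <- Hgh by exact Hz0; exact H0. }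
rewrite (Hgh w Hw0), Cmod_pow; apply pow_incr; split; [apply Cmod_ge_0|].
replace (g w) with ((g w - g z0) + g z0)%C by ring.
eapply Rle_trans; [apply Cmod_triangle|].
assert (HB : 1 / (R0 / 2) * Cmod (w - z0) <= 1 / 2).
{ apply Rle_trans with (1 / (R0 / 2) * (R0 / 4)); [|right; field; lra].
  apply Rmult_le_compat_l; [|unfold Cball in Hw; lra].
  apply Rlt_le, Rdiv_lt_0_compat; lra. }
lra.
Qed.

(** * Limits along an ultrafilter *)

(** The last clause puts every tail of nat into [W]: the ultrafilter is free, and limits along it
    extend ordinary limits. *)
Definition is_ultrafilter (W : (nat -> Prop) -> Prop) : Prop :=
  ProperFilter W /\ (forall P, W P \/ W (fun n => ~ P n)) /\ filter_le W eventually.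

Lemma ultrafilter_exists : exists W, is_ultrafilter W.
Proof.
assert (HE : filter.ProperFilter (eventually : classical_sets.set_system nat)).
{ split.
  - intros [N HN]; exact (HN N (Nat.le_refl N)).
  - split.
    + exists 0%nat; intros n _; exact I.
    + intros P Q; exact (filter_and (F := eventually) P Q).
    + intros P Q; exact (filter_imp (F := eventually) P Q). }
destruct (filter.ultraFilterLemma HE) as [W [HW HEW]].
exists W; split; [|split].
- split.
  + intros P HP; exact (@filter.filter_ex _ _ (@filter.ultra_proper _ _ HW) P HP).
  + destruct (@filter.filter_filter _ _ (@filter.ultra_proper _ _ HW)) as [HT HI HS]; split.
    * exact HT.
    * intros P Q; exact (HI P Q).
    * intros P Q; exact (HS P Q).
- intros P; exact (filter.in_ultra_setVsetC P HW).
- exact HEW.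
Qed.

Section Ultralimit.
Variable W : (nat -> Prop) -> Prop.
Hypothesis HW : is_ultrafilter W.

#[local] Instance ultra_proper : ProperFilter W := proj1 HW.

Definition ulim (u : nat -> C) (l : C) : Prop :=
  forall eps, 0 < eps -> W (fun n => Cmod (u n - l) < eps).

(** The limit is the supremum l of the x with x <= u n for [W]-almost all n. Since l + eps is not
    such an x, the ultrafilter dichotomy gives u n < l + eps almost everywhere. *)
Lemma ultra_bounded_real (u : nat -> R) (M : R) :
  (forall n, Rabs (u n) <= M) ->
  exists l, forall eps, 0 < eps -> W (fun n => Rabs (u n - l) < eps).
Proof.
intros HM.
assert (HM' : forall n, - M <= u n <= M) by (intros n; apply Rabs_le_between, HM).
destruct (completeness (fun x => W (fun n => x <= u n))) as [l [Hl1 Hl2]].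
- exists M; intros x Hx; destruct (filter_ex _ Hx) as [n Hn]; generalize (HM' n); lra.
- exists (- M); apply filter_forall; intros n; apply HM'.
- exists l; intros eps He.
  assert (H1 : W (fun n => ~ l + eps <= u n)).
  { destruct (proj1 (proj2 HW) (fun n => l + eps <= u n)) as [H|H]; [|exact H].
    apply Hl1 in H; lra. }
  assert (H2 : exists x, W (fun n => x <= u n) /\ l - eps < x).
  { apply NNPP; intros Hno; apply (Rlt_not_le l (l - eps)); [lra|].
    apply Hl2; intros x Hx; apply Rnot_lt_le; intros Hlt; apply Hno; exists x; split; assumption. }
  destruct H2 as [x [Hx Hlx]].
  apply (filter_imp (fun n => ~ l + eps <= u n /\ x <= u n)); [|apply filter_and; assumption].
  intros n [A B]; apply Rabs_def1; lra.
Qed.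

Lemma ulim_exists (u : nat -> C) (M : R) : (forall n, Cmod (u n) <= M) -> exists l, ulim u l.
Proof.
intros HM.
destruct (ultra_bounded_real (fun n => fst (u n)) M) as [x Hx].
{ intros n; eapply Rle_trans; [|apply HM]; eapply Rle_trans; [|apply Rmax_Cmod]; apply Rmax_l. }
destruct (ultra_bounded_real (fun n => snd (u n)) M) as [y Hy].
{ intros n; eapply Rle_trans; [|apply HM]; eapply Rle_trans; [|apply Rmax_Cmod]; apply Rmax_r. }
exists (x, y); intros eps He.
apply (filter_imp (fun n => Rabs (fst (u n) - x) < eps / 2 /\ Rabs (snd (u n) - y) < eps / 2)).
2:{ apply filter_and; [apply Hx|apply Hy]; lra. }
intros n [A B].
replace (u n - (x, y))%C with (RtoC (fst (u n) - x) + Ci * RtoC (snd (u n) - y))%C.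
2:{ destruct (u n) as [a b]; apply injective_projections; simpl; ring. }
eapply Rle_lt_trans; [apply Cmod_triangle|].
rewrite Cmod_mult, Cmod_Ci, !Cmod_R; lra.
Qed.

Lemma ulim_const (c : C) : ulim (fun _ => c) c.
Proof.
intros eps He; apply filter_forall; intros n; apply Cball_center, He.
Qed.

Lemma ulim_minus (u v : nat -> C) (l m : C) :
  ulim u l -> ulim v m -> ulim (fun n => u n - v n)%C (l - m)%C.
Proof.
intros Hu Hv eps He.
apply (filter_imp (fun n => Cmod (u n - l) < eps / 2 /\ Cmod (v n - m) < eps / 2)).
2:{ apply filter_and; [apply Hu|apply Hv]; lra. }
intros n [A B].
replace (u n - v n - (l - m))%C with ((u n - l) + - (v n - m))%C by ring.
eapply Rle_lt_trans; [apply Cmod_triangle|]; rewrite Cmod_opp; lra.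
Qed.

Lemma ulim_scal (c : C) (u : nat -> C) (l : C) :
  ulim u l -> ulim (fun n => c * u n)%C (c * l)%C.
Proof.
intros Hu eps He.
assert (Hc : 0 < Cmod c + 1) by (generalize (Cmod_ge_0 c); lra).
apply (filter_imp (fun n => Cmod (u n - l) < eps / (Cmod c + 1))).
2:{ apply Hu, Rdiv_lt_0_compat; lra. }
intros n A.
replace (c * u n - c * l)%C with (c * (u n - l))%C by ring; rewrite Cmod_mult.
apply Rle_lt_trans with ((Cmod c + 1) * Cmod (u n - l)).
- apply Rmult_le_compat_r; [apply Cmod_ge_0|lra].
- apply (Rmult_lt_compat_l (Cmod c + 1)) in A; [|exact Hc].
  replace eps with ((Cmod c + 1) * (eps / (Cmod c + 1))) by (field; lra); exact A.
Qed.

Lemma ulim_le (u : nat -> C) (l : C) (M : R) :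
  W (fun n => Cmod (u n) <= M) -> ulim u l -> Cmod l <= M.
Proof.
intros HM Hu; apply le_epsilon; intros eps He.
destruct (filter_ex _ (filter_and _ _ HM (Hu eps He))) as [n [A B]].
replace l with (u n + - (u n - l))%C by ring.
eapply Rle_trans; [apply Cmod_triangle|]; rewrite Cmod_opp; lra.
Qed.

Lemma ulim_unique (u : nat -> C) (l m : C) : ulim u l -> ulim u m -> l = m.
Proof.
intros Hl Hm; apply Ceq_minus, Cmod_eq_0, Rle_antisym; [|apply Cmod_ge_0].
refine (ulim_le _ _ 0 _ (ulim_minus _ _ _ _ Hl Hm)); apply filter_forall; intros n.
replace (u n - u n)%C with (RtoC 0) by ring; rewrite Cmod_0; lra.
Qed.

(** The constant [K] is the same for all n, so the quadratic remainder bound passes to the limit; it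
    is below eps |w - z| once |K| |w - z| is below eps. *)
Lemma ulim_taylor (f : nat -> C -> C) (f' : nat -> C -> C) (z : C) (r K : R) (g : C -> C) (d : C) :
  0 < r ->
  (forall n w, Cball z r w -> Cmod (f n w - f n z - (w - z) * f' n z) <= K * (Cmod (w - z) * Cmod (w - z))) ->
  (forall w, Cball z r w -> ulim (fun n => f n w) (g w)) ->
  ulim (fun n => f' n z) d -> Cder g z d.
Proof.
intros Hr HK Hg Hd; apply Cder_eps; intros eps He.
assert (HK1 : 0 < Rabs K + 1) by (generalize (Rabs_pos K); lra).
exists (Rmin r (eps / (Rabs K + 1))); split.
{ apply Rmin_pos; [exact Hr|]; apply Rdiv_lt_0_compat; assumption. }
intros w Hw.
assert (Hwr : Cball z r w) by (eapply Rlt_le_trans; [exact Hw|apply Rmin_l]).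
assert (Hwe : Cmod (w - z) < eps / (Rabs K + 1)) by (eapply Rlt_le_trans; [exact Hw|apply Rmin_r]).
assert (H0 := Cmod_ge_0 (w - z)).
apply Rle_trans with (K * (Cmod (w - z) * Cmod (w - z))).
- apply (ulim_le (fun n => f n w - f n z - (w - z) * f' n z)%C).
  + apply filter_forall; intros n; apply HK, Hwr.
  + apply ulim_minus; [apply ulim_minus; apply Hg; [exact Hwr|apply Cball_center, Hr]|].
    apply ulim_scal, Hd.
- rewrite <- Rmult_assoc; apply Rmult_le_compat_r; [exact H0|].
  apply Rle_trans with ((Rabs K + 1) * (eps / (Rabs K + 1))); [|right; field; lra].
  apply Rle_trans with (Rabs K * Cmod (w - z)).
  + apply Rmult_le_compat_r; [exact H0|apply Rle_abs].
  + apply Rmult_le_compat; [apply Rabs_pos|exact H0|lra|lra].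
Qed.

(** Two Cauchy estimates bound f' by 1/r and then f'' by 1/r^2; two applications of the mean value
    inequality then bound the remainder. *)
Lemma cauchy_taylor (f f' : C -> C) (z : C) (r : R) :
  0 < r -> C1_on (Cball z (4 * r)) f f' -> (forall w, Cball z (4 * r) w -> Cmod (f w) <= 1) ->
  forall w, Cball z r w -> Cmod (f w - f z - (w - z) * f' z) <= / (r * r) * (Cmod (w - z) * Cmod (w - z)).
Proof.
intros Hr Hf HM w Hw.
destruct (C1_on_derivative _ f f' (Copen_Cball z (4 * r)) Hf) as [f'' Hf'].
assert (Hsub : forall s t x, s + t <= 4 * r -> Cball z s x -> forall v, Cball x t v -> Cball z (4 * r) v).
{ intros s t x Hst Hx v Hv; apply Rlt_le_trans with (s + t); [exact (Cball_trans z x v _ _ Hx Hv)|exact Hst]. }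
(* Each estimate is taken at radius r in a disc of radius 3r/2, so the nested discs about z have
   radii r, 5r/2 and 4r. *)
assert (E1 : forall x, Cball z (2 * r + r / 2) x -> Cmod (f' x) <= 1 / r).
{ intros x Hx.
  assert (S := Hsub (2 * r + r / 2) (r + r / 2) x ltac:(lra) Hx).
  apply (cauchy_estimate f f' x (r + r / 2) r 1); [exact (C1_on_mono _ _ _ _ S Hf)|lra|].
  intros v Hv; apply HM, S, Hv. }
assert (E2 : forall x, Cball z r x -> Cmod (f'' x) <= / (r * r)).
{ intros x Hx.
  assert (S := Hsub r (r + r / 2) x ltac:(lra) Hx).
  replace (/ (r * r)) with (1 / r / r) by (field; lra).
  apply (cauchy_estimate f' f'' x (r + r / 2) r (1 / r)); [exact (C1_on_mono _ _ _ _ S Hf')|lra|].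
  intros v Hv; apply E1; replace (2 * r + r / 2) with (r + (r + r / 2)) by ring.
  exact (Cball_trans z x v _ _ Hx Hv). }
set (rho := Cmod (w - z)).
assert (Hb : forall x, Cball z r x -> Cball z (4 * r) x) by (unfold Cball; intros; lra).
assert (L : forall x, Cball z r x -> Cmod (f' x - f' z) <= / (r * r) * Cmod (x - z)).
{ intros x Hx; apply (Cder_mean_value f' f'' z r); [intros y Hy; apply Hf', Hb, Hy|exact E2| |exact Hx].
  apply Cball_center, Hr. }
assert (Hir : 0 < / (r * r)) by (apply Rinv_0_lt_compat, Rmult_lt_0_compat; exact Hr).
assert (M := Rder_mean_value (fun s => f (z + s * (w - z)) - (0 + s * ((w - z) * f' z)))%C
  (fun s => (w - z) * f' (z + s * (w - z)) - (w - z) * f' z)%C 0 1 (/ (r * r) * (rho * rho)) Rle_0_1).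
cbv beta in M.
replace (f w - f z - (w - z) * f' z)%C with
  (f (z + 1 * (w - z)) - (0 + 1 * ((w - z) * f' z)) - (f (z + 0 * (w - z)) - (0 + 0 * ((w - z) * f' z))))%C.
2:{ replace (z + 1 * (w - z))%C with w by ring; replace (z + 0 * (w - z))%C with z by ring; ring. }
replace (/ (r * r) * (rho * rho)) with (/ (r * r) * (rho * rho) * (1 - 0)) by ring.
assert (Hseg : forall t, 0 <= t <= 1 -> Cball z r (z + t * (w - z))).
{ intros t Ht; apply segment_ball; [apply Cball_center, Hr|exact Hw|exact Ht]. }
apply M.
- intros t Ht; apply Rder_minus; [|apply Rder_line].
  apply (Rder_comp f (fun s => z + s * (w - z))%C); [|apply Rder_line].
  apply Hf, Hb, Hseg, Ht.
- intros t Ht.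
  replace ((w - z) * f' (z + t * (w - z)) - (w - z) * f' z)%C
    with ((w - z) * (f' (z + t * (w - z)) - f' z))%C by ring.
  rewrite Cmod_mult; fold rho.
  replace (/ (r * r) * (rho * rho)) with (rho * (/ (r * r) * rho)) by ring.
  apply Rmult_le_compat_l; [apply Cmod_ge_0|].
  eapply Rle_trans; [apply L, Hseg, Ht|]; apply Rmult_le_compat_l; [lra|].
  replace (z + t * (w - z) - z)%C with (t * (w - z))%C by ring.
  rewrite Cmod_mult, Cmod_R, Rabs_pos_eq by lra; fold rho.
  rewrite <- (Rmult_1_l rho) at 2; apply Rmult_le_compat_r; [apply Cmod_ge_0|lra].
Qed.

Lemma ultralimit_holomorphic (D : C -> Prop) (f f' : nat -> C -> C) :
  Copen D -> (forall n, C1_on D (f n) (f' n)) -> (forall n z, D z -> Cmod (f n z) <= 1) ->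
  exists g g', forall z, D z ->
    ulim (fun n => f n z) (g z) /\ ulim (fun n => f' n z) (g' z) /\ Cder g z (g' z).
Proof.
intros HD Hf HM.
(* Off [D] the limit is given the default value 0, so that choice produces total functions. *)
assert (HL : forall z, exists l, D z -> ulim (fun n => f n z) l).
{ intros z; destruct (classic (D z)) as [Hz|Hz]; [|exists 0; intros; contradiction].
  destruct (ulim_exists (fun n => f n z) 1 (fun n => HM n z Hz)) as [l Hl]; exists l; auto. }
assert (HL' : forall z, exists l, D z -> ulim (fun n => f' n z) l).
{ intros z; destruct (classic (D z)) as [Hz|Hz]; [|exists 0; intros; contradiction].
  destruct (HD z Hz) as [r [Hr HrD]].
  destruct (ulim_exists (fun n => f' n z) (1 / (r / 2))) as [l Hl]; [|exists l; auto].
  intros n; apply (cauchy_estimate (f n) (f' n) z r); [exact (C1_on_mono _ _ _ _ HrD (Hf n))|lra|].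
  intros w Hw; apply HM, HrD, Hw. }
exists (fun z => proj1_sig (constructive_indefinite_description _ (HL z))).
exists (fun z => proj1_sig (constructive_indefinite_description _ (HL' z))).
assert (G : forall z, D z -> ulim (fun n => f n z) (proj1_sig (constructive_indefinite_description _ (HL z)))).
{ intros z Hz; destruct (constructive_indefinite_description _ (HL z)); auto. }
assert (G' : forall z, D z -> ulim (fun n => f' n z) (proj1_sig (constructive_indefinite_description _ (HL' z)))).
{ intros z Hz; destruct (constructive_indefinite_description _ (HL' z)); auto. }
intros z Hz; split; [apply G, Hz|split; [apply G', Hz|]].
destruct (HD z Hz) as [r0 [Hr0 HrD]].
set (r := r0 / 4).
assert (Hr : 0 < r) by (unfold r; lra).
replace r0 with (4 * r) in HrD by (unfold r; field).
apply (ulim_taylor f f' z r (/ (r * r))); [exact Hr| | |apply G', Hz].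
- intros n; apply cauchy_taylor; [exact Hr|exact (C1_on_mono _ _ _ _ HrD (Hf n))|].
  intros w Hw; apply HM, HrD, Hw.
- intros w Hw; apply G, HrD; unfold Cball in *; lra.
Qed.

(** For a given eps, N is fixed first with (3/4)^(2^N) < eps. For [W]-almost all n the value of h n
    at z0 is below (1/4)^(2^N) in modulus, and [small_value_spreads] carries the smallness to w. *)
Lemma hurwitz_zero (z0 w : C) (R0 : R) (h h' : nat -> C -> C) (l : C) :
  (forall n, C1_on (Cball z0 R0) (h n) (h' n)) ->
  (forall n z, Cball z0 R0 z -> h n z <> 0) ->
  (forall n z, Cball z0 R0 z -> Cmod (h n z) <= 1) ->
  Cball z0 (R0 / 4) w ->
  ulim (fun n => h n z0) 0 -> ulim (fun n => h n w) l -> l = 0.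
Proof.
intros Hh Hn H1 Hw H0 Hl.
apply Cmod_eq_0, Rle_antisym; [|apply Cmod_ge_0].
apply le_epsilon; intros eps He; rewrite Rplus_0_l.
assert (H34 : Rabs (3 / 4) < 1) by (rewrite Rabs_pos_eq; lra).
destruct (pow_lt_1_zero _ H34 eps He) as [N HN].
assert (Hj : (2 ^ N >= N)%nat) by (apply Nat.lt_le_incl, Nat.pow_gt_lin_r; lia).
apply Rle_trans with ((3 / 4) ^ (2 ^ N)).
2:{ generalize (HN _ Hj); intros H; eapply Rle_trans; [apply Rle_abs|lra]. }
refine (ulim_le _ _ _ _ Hl).
apply (filter_imp (fun n => Cmod (h n z0 - 0) < (1 / 4) ^ (2 ^ N))).
2:{ apply H0, pow_lt; lra. }
intros n Hsmall; apply (small_value_spreads z0 R0 (h n) (h' n)); auto.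
replace (h n z0) with (h n z0 - 0)%C by ring; lra.
Qed.
End Ultralimit.

(** * The extremal problem *)

Lemma C1_on_ext_derivative (D : C -> Prop) (f f' g' : C -> C) :
  Copen D -> (forall z, D z -> f' z = g' z) -> C1_on D f f' -> C1_on D f g'.
Proof.
intros HD E Hf z Hz; destruct (Hf z Hz) as [H1 H2]; rewrite <- E by exact Hz; split; [exact H1|].
destruct (HD z Hz) as [r [Hr HrD]].
refine (@continuous_ext_loc CU CU g' f' z _ H2).
exists (mkposreal r Hr); intros w Hw; apply E, HrD; exact Hw.
Qed.

Lemma C1_on_minus (D : C -> Prop) (f f' g g' : C -> C) :
  C1_on D f f' -> C1_on D g g' -> C1_on D (fun z => f z - g z)%C (fun z => f' z - g' z)%C.
Proof.
intros Hf Hg z Hz; destruct (Hf z Hz) as [H1 H2]; destruct (Hg z Hz) as [H3 H4]; split.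
- exact (Cder_minus _ _ _ _ _ H1 H3).
- apply (@cont_minus CU); assumption.
Qed.

Lemma C1_on_id (D : C -> Prop) : C1_on D (fun z => z) (fun _ => RtoC 1).
Proof. intros z _; split; [apply Cder_id|apply (@cont_const CU)]. Qed.

Lemma Copen_unit_disc : Copen unit_disc.
Proof.
intros z Hz; destruct (Copen_Cball 0 1 z) as [r [Hr H]].
- unfold Cball; replace (z - 0)%C with z by ring; exact Hz.
- exists r; split; [exact Hr|]; intros w Hw; generalize (H w Hw).
  unfold Cball; replace (w - 0)%C with w by ring; exact (fun h => h).
Qed.

(** * Moebius transformations of the disc *)

Definition mobius (w z : C) : C := ((z - w) * / (1 - Cconj w * z))%C.

Definition mobius' (w z : C) : C :=
  ((1 - Cconj w * w) * / ((1 - Cconj w * z) * (1 - Cconj w * z)))%C.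

Lemma Cconj_mul_self (w : C) : (Cconj w * w = (Cmod w ^ 2)%R)%C.
Proof. rewrite Cmod2_conj; ring. Qed.

Lemma disc_sqr_lt (w : C) : unit_disc w -> 0 < 1 - Cmod w ^ 2.
Proof. unfold unit_disc; intros H; generalize (Cmod_ge_0 w); intros; nra. Qed.

Lemma mobius_denominator (w z : C) : unit_disc w -> unit_disc z -> (1 - Cconj w * z)%C <> 0.
Proof.
unfold unit_disc; intros Hw Hz E.
assert (H : (Cconj w * z)%C = 1).
{ replace (Cconj w * z)%C with (1 - (1 - Cconj w * z))%C by ring; rewrite E; ring. }
assert (H' : Cmod w * Cmod z = 1) by (rewrite <- (Cmod_conj w), <- Cmod_mult, H; apply Cmod_1).
generalize (Cmod_ge_0 w) (Cmod_ge_0 z); intros; nra.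
Qed.

Lemma C1_on_mobius (w : C) : unit_disc w -> C1_on unit_disc (mobius w) (mobius' w).
Proof.
intros Hw.
assert (Hd := C1_on_minus unit_disc _ _ _ _ (C1_on_const unit_disc 1)
  (C1_on_mult _ _ _ _ _ (C1_on_const unit_disc (Cconj w)) (C1_on_id unit_disc))).
assert (Hn := C1_on_minus unit_disc _ _ _ _ (C1_on_id unit_disc) (C1_on_const unit_disc w)).
assert (H := C1_on_mult _ _ _ _ _ Hn (C1_on_comp _ _ _ _ _ _ C1_on_Cinv Hd
  (fun z => mobius_denominator w z Hw))).
refine (C1_on_ext_derivative _ _ _ _ Copen_unit_disc _ H).
intros z Hz; unfold mobius'; field; exact (mobius_denominator w z Hw Hz).
Qed.

(** The squared moduli of denominator and numerator differ by (1 - |w|^2)(1 - |z|^2), which is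
    positive. *)
Lemma mobius_unit_disc (w z : C) : unit_disc w -> unit_disc z -> unit_disc (mobius w z).
Proof.
intros Hw Hz.
assert (Hd := mobius_denominator w z Hw Hz).
assert (Hd' := proj1 (Cmod_gt_0 _) Hd).
unfold unit_disc, mobius; rewrite Cmod_mult, Cmod_inv by exact Hd.
apply (Rmult_lt_reg_r (Cmod (1 - Cconj w * z))); [exact Hd'|].
rewrite Rmult_assoc, Rinv_l, Rmult_1_r, Rmult_1_l by lra.
apply Rnot_le_lt; intros Hle.
assert (E : Cmod (1 - Cconj w * z) ^ 2 - Cmod (z - w) ^ 2 = (1 - Cmod w ^ 2) * (1 - Cmod z ^ 2)).
{ rewrite !Cmod2_alt; destruct w as [a b]; destruct z as [c d]; unfold Re, Im; simpl; ring. }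
assert (P := Rmult_lt_0_compat _ _ (disc_sqr_lt w Hw) (disc_sqr_lt z Hz)).
assert (Q : Cmod (1 - Cconj w * z) ^ 2 <= Cmod (z - w) ^ 2) by (apply pow_incr; lra).
lra.
Qed.

(** The values at z1 and z2 differ by (z1 - z2)(1 - |w|^2) over the product of the two
    denominators. *)
Lemma mobius_injective (w z1 z2 : C) :
  unit_disc w -> unit_disc z1 -> unit_disc z2 -> mobius w z1 = mobius w z2 -> z1 = z2.
Proof.
intros Hw H1 H2 E.
assert (D1 := mobius_denominator w z1 Hw H1); assert (D2 := mobius_denominator w z2 Hw H2).
assert (Hs : (1 - Cconj w * w)%C <> 0).
{ rewrite Cconj_mul_self, <- RtoC_minus; intros E'; apply RtoC_inj in E'.
  generalize (disc_sqr_lt w Hw); lra. }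
apply Ceq_minus.
replace (z1 - z2)%C with ((mobius w z1 - mobius w z2) *
  ((1 - Cconj w * z1) * (1 - Cconj w * z2)) * / (1 - Cconj w * w))%C.
- rewrite E; ring.
- unfold mobius; field; auto.
Qed.

Section RiemannMapping.
Variable U : C -> Prop.
Hypothesis U_open : Copen U.
Hypothesis U_connected : forall P : C -> Prop,
  (forall z, U z -> P z -> exists r, 0 < r /\ forall w, Cball z r w -> P w) ->
  (forall z, U z -> ~ P z -> exists r, 0 < r /\ forall w, Cball z r w -> ~ P w) ->
  (exists z, U z /\ P z) -> forall z, U z -> P z.
Hypothesis U_antiderivative : forall f, holomorphic_on U f ->
  exists F, forall z, U z -> Cder F z (f z).

(** An antiderivative of f is of class C^1, because f is differentiable and so continuous;
    [C1_on_derivative] applied to it makes f of class C^1. *)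
Lemma holomorphic_C1 (f : C -> C) : holomorphic_on U f -> exists f', C1_on U f f'.
Proof.
intros Hf; destruct (U_antiderivative f Hf) as [F HF].
apply (C1_on_derivative U F f U_open); intros z Hz; split; [apply HF, Hz|].
destruct (Hf z Hz) as [d Hd]; exact (Cder_cont _ _ _ Hd).
Qed.

Lemma C1_holomorphic (f f' : C -> C) : C1_on U f f' -> holomorphic_on U f.
Proof. intros Hf z Hz; exists (f' z); apply Hf, Hz. Qed.

Lemma primitive_on_U (f f' : C -> C) : C1_on U f f' -> exists F, C1_on U F f.
Proof.
intros Hf; destruct (U_antiderivative f (C1_holomorphic f f' Hf)) as [F HF].
exists F; intros z Hz; split; [apply HF, Hz|exact (Cder_cont _ _ _ (proj1 (Hf z Hz)))].
Qed.

(** Continuity makes the set where f differs from c open, so connectedness asks only for openness of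
    the level set. *)
Lemma constant_of_open_level (f : C -> C) (c : C) :
  (forall z, U z -> continuous (T := CU) (U := CU) f z) ->
  (forall z, U z -> f z = c -> exists r, 0 < r /\ forall w, Cball z r w -> f w = c) ->
  (exists z, U z /\ f z = c) -> forall z, U z -> f z = c.
Proof.
intros Hc Ho He; apply U_connected; [exact Ho| |exact He].
intros z Hz Hne.
assert (Hp : 0 < Cmod (f z - c)).
{ apply Cmod_gt_0; intros E; apply Hne, Ceq_minus, E. }
destruct (proj1 (cont_eps f z) (Hc z Hz) _ Hp) as [d [Hd H]].
exists d; split; [exact Hd|]; intros w Hw E.
specialize (H w Hw); rewrite E in H.
replace (c - f z)%C with (- (f z - c))%C in H by ring; rewrite Cmod_opp in H; lra.
Qed.

Lemma derivative_zero_on_U (f : C -> C) :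
  (forall z, U z -> Cder f z (RtoC 0)) -> forall z w, U z -> U w -> f z = f w.
Proof.
intros Hf z w Hz Hw; apply (constant_of_open_level f (f w)); [| |exists w; auto|exact Hz].
- intros x Hx; exact (Cder_cont _ _ _ (Hf x Hx)).
- intros x Hx E; destruct (U_open x Hx) as [r [Hr HrU]]; exists r; split; [exact Hr|].
  intros y Hy; rewrite <- E; apply (derivative_zero_on_ball x r); [|exact Hy|apply Cball_center, Hr].
  intros v Hv; apply Hf, HrU, Hv.
Qed.

Lemma sqrt_on_U (h h' : C -> C) :
  C1_on U h h' -> (forall z, U z -> h z <> 0) ->
  exists g g', C1_on U g g' /\ forall z, U z -> (g z * g z)%C = h z.
Proof. exact (holomorphic_sqrt U primitive_on_U derivative_zero_on_U U_open h h'). Qed.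

Lemma sqrt_derivative (g g' h h' : C -> C) (z : C) :
  C1_on U g g' -> C1_on U h h' -> (forall w, U w -> (g w * g w)%C = h w) -> U z ->
  (2 * g z * g' z)%C = h' z.
Proof.
intros Hg Hh E Hz; destruct (U_open z Hz) as [r [Hr HrU]].
apply (Cder_unique h z); [|apply Hh, Hz].
refine (Cder_eq _ _ (g' z * g z + g z * g' z)%C _ _ _); [ring|].
apply (Cder_ext_ball (fun w => g w * g w)%C h z _ r Hr); [intros w Hw; apply E, HrU, Hw|].
apply Cder_mult; apply Hg, Hz.
Qed.

Variable a : C.
Hypothesis Ua : U a.

(** The competitors in the extremal problem for |f'(a)|. *)
Definition normalized (f f' : C -> C) : Prop :=
  C1_on U f f' /\ f a = 0 /\ (forall z, U z -> unit_disc (f z)) /\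
  (forall z w, U z -> U w -> f z = f w -> z = w).

(** With g^2 = z - c, the function g stays away from -g(a), so 1/(g + g(a)) is bounded and
    injective; subtracting its value at a and rescaling gives a competitor. *)
Lemma normalized_exists : ~ (forall z, U z) -> exists f f', normalized f f' /\ f' a <> 0.
Proof.
intros Hne; apply not_all_ex_not in Hne; destruct Hne as [c Hc].
assert (Hh := C1_on_minus U _ _ _ _ (C1_on_id U) (C1_on_const U c)).
assert (Hh0 : forall z, U z -> (z - c)%C <> 0).
{ intros z Hz E; apply Hc; apply Ceq_minus in E; rewrite <- E; exact Hz. }
destruct (sqrt_on_U _ _ Hh Hh0) as [g [g' [Hg Hgg]]]; cbv beta in Hgg.
assert (Hd : (2 * g a * g' a)%C = 1).
{ rewrite (sqrt_derivative g g' _ _ a Hg Hh Hgg Ua); ring. }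
assert (H2 : RtoC 2 <> 0) by (intros E; apply RtoC_inj in E; lra).
assert (Hga : g a <> 0) by (intros E; rewrite E in Hd; apply C1_nz; rewrite <- Hd; ring).
assert (Hg'a : g' a <> 0) by (intros E; rewrite E in Hd; apply C1_nz; rewrite <- Hd; ring).
set (m := Cmod (g a)).
assert (Hm : 0 < m) by (apply Cmod_gt_0, Hga).
(* [g] misses a neighbourhood of [- g a], because [g z ^ 2 = z - c] determines [z]. *)
assert (Hrho : exists rho, 0 < rho /\ forall z, U z -> rho <= Cmod (g z + g a)).
{ destruct (proj1 (cont_eps g a) (Cder_cont _ _ _ (proj1 (Hg a Ua))) m Hm) as [d [Hd1 Hd2]].
  set (e := d / (2 * (1 + 2 * m))).
  assert (He : 0 < e) by (apply Rdiv_lt_0_compat; lra).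
  (* Let s = |g z + g a| be smaller than this. If |z - a| < d, then |g z - g a| < m contradicts 2m
     <= s + |g z - g a|. Otherwise |z - a| = s |g z - g a| <= e (1 + 2m) = d/2, using s < 1. *)
  exists (Rmin m (Rmin 1 e)); split; [repeat apply Rmin_pos; lra|].
  intros z Hz; apply Rnot_lt_le; intros Hlt.
  assert (M1 := Rmin_l m (Rmin 1 e)); assert (M2 := Rmin_r m (Rmin 1 e)).
  assert (M3 := Rmin_l 1 e); assert (M4 := Rmin_r 1 e).
  set (s := Cmod (g z + g a)) in *.
  assert (Hs := Cmod_ge_0 (g z + g a)); fold s in Hs.
  assert (T1 : 2 * m <= s + Cmod (g z - g a)).
  { generalize (Cmod_triangle (g z + g a) (- (g z - g a))); rewrite Cmod_opp.
    replace (g z + g a + - (g z - g a))%C with (2 * g a)%C by ring.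
    rewrite Cmod_mult, Cmod_R, Rabs_pos_eq by lra; fold s m; lra. }
  assert (T2 : Cmod (g z - g a) <= s + 2 * m).
  { generalize (Cmod_triangle (g z + g a) (- (2 * g a))); rewrite Cmod_opp.
    replace (g z + g a + - (2 * g a))%C with (g z - g a)%C by ring.
    rewrite Cmod_mult, Cmod_R, Rabs_pos_eq by lra; fold s m; lra. }
  destruct (Rlt_le_dec (Cmod (z - a)) d) as [Hza|Hza].
  - specialize (Hd2 z Hza); lra.
  - assert (E : Cmod (z - a) = s * Cmod (g z - g a)).
    { unfold s; rewrite <- Cmod_mult; f_equal.
      transitivity ((z - c) - (a - c))%C; [ring|].
      rewrite <- (Hgg z Hz), <- (Hgg a Ua); ring. }
    assert (B : s * Cmod (g z - g a) <= e * (1 + 2 * m)).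
    { apply Rmult_le_compat; [exact Hs|apply Cmod_ge_0|lra|lra]. }
    assert (e * (1 + 2 * m) = d / 2) by (unfold e; field; lra). lra. }
destruct Hrho as [rho [Hr Hrho]].
assert (Hnz : forall z, U z -> (g z - - g a)%C <> 0).
{ intros z Hz; apply Cmod_gt_0; replace (g z - - g a)%C with (g z + g a)%C by ring.
  generalize (Hrho z Hz); lra. }
set (k := (/ (g a - - g a))%C).
(* Both reciprocals are at most 1/rho in modulus, so the factor rho/3 brings their difference down
   to at most 2/3. *)
assert (HF := C1_on_mult U _ _ _ _ (C1_on_const U (rho / 3)%R)
  (C1_on_minus U _ _ _ _ (C1_on_comp U _ _ _ _ _ C1_on_Cinv
    (C1_on_minus U _ _ _ _ Hg (C1_on_const U (- g a)%C)) Hnz) (C1_on_const U k))).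
assert (Hinv : forall z, U z -> Cmod (/ (g z - - g a)) <= / rho).
{ intros z Hz; rewrite Cmod_inv by (apply Hnz, Hz).
  apply Rinv_le_contravar; [exact Hr|].
  replace (g z - - g a)%C with (g z + g a)%C by ring; apply Hrho, Hz. }
assert (Hr3 : RtoC (rho / 3) <> 0) by (intros E; apply RtoC_inj in E; lra).
eexists; eexists; split; [split; [exact HF|split; [|split]]|].
- unfold k; ring.
- intros z Hz; unfold unit_disc; rewrite Cmod_mult, Cmod_R, Rabs_pos_eq by lra.
  apply Rle_lt_trans with (rho / 3 * (/ rho + / rho)).
  + apply Rmult_le_compat_l; [lra|].
    eapply Rle_trans; [apply Cmod_triangle|]; rewrite Cmod_opp.
    apply Rplus_le_compat; apply Hinv; assumption.
  + replace (rho / 3 * (/ rho + / rho)) with (2 / 3) by (field; lra); lra.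
- intros z w Hz Hw E; cbv beta in E.
  assert (E2 : (/ (g z - - g a) = / (g w - - g a))%C).
  { transitivity (/ (rho / 3)%R * ((rho / 3)%R * (/ (g z - - g a) - k)) + k)%C.
    - field; split; [apply Hnz, Hz|exact Hr3].
    - rewrite E; field; split; [apply Hnz, Hw|exact Hr3]. }
  assert (E3 : g z = g w).
  { transitivity (/ / (g z - - g a) + - g a)%C; [field; apply Hnz, Hz|].
    rewrite E2; field; apply Hnz, Hw. }
  apply Ceq_minus; transitivity ((z - c) - (w - c))%C; [ring|].
  rewrite <- (Hgg z Hz), <- (Hgg w Hw), E3; ring.
- intros E; cbv beta in E; apply Hg'a.
  assert (Hn := Hnz a Ua).
  transitivity (- / (rho / 3)%R * ((g a - - g a) * (g a - - g a)) * RtoC 0)%C; [|ring].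
  rewrite <- E; field; split; assumption.
Qed.

(** The better map is [mobius b] after g, where g is a square root of [mobius w] after f, and b =
    g(a). With t = |b| one has t^2 = |w|, and the chain rule multiplies |f'(a)| by (1 - t^4) / (2t
    (1 - t^2)) = (1 + t^2) / (2t), which exceeds 1 for 0 < t < 1. *)
Lemma normalized_improve (f f' : C -> C) (w : C) :
  normalized f f' -> f' a <> 0 -> unit_disc w -> (forall z, U z -> f z <> w) ->
  exists g g', normalized g g' /\ Cmod (f' a) < Cmod (g' a).
Proof.
intros [Hf [Hfa [Hfd Hfi]]] Hf'a Hw Hmiss.
assert (Hphi := C1_on_comp U unit_disc _ _ _ _ (C1_on_mobius w Hw) Hf Hfd).
assert (Hphi0 : forall z, U z -> mobius w (f z) <> 0).
{ intros z Hz E; apply (Hmiss z Hz); apply Ceq_minus.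
  assert (Hdn := mobius_denominator w (f z) Hw (Hfd z Hz)).
  transitivity (mobius w (f z) * (1 - Cconj w * f z))%C; [unfold mobius; field; exact Hdn|].
  rewrite E; ring. }
destruct (sqrt_on_U _ _ Hphi Hphi0) as [g [g' [Hg Hgg]]]; cbv beta in Hgg.
assert (Hgm : forall z, U z -> Cmod (g z) * Cmod (g z) = Cmod (mobius w (f z))).
{ intros z Hz; rewrite <- Cmod_mult, Hgg by exact Hz; reflexivity. }
assert (Hgd : forall z, U z -> unit_disc (g z)).
{ intros z Hz; assert (H := mobius_unit_disc w (f z) Hw (Hfd z Hz)).
  unfold unit_disc in *; rewrite <- Hgm in H by exact Hz.
  generalize (Cmod_ge_0 (g z)); intros; nra. }
assert (Hb := Hgd a Ua); set (b := g a) in *.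
assert (Hmw : Cmod b * Cmod b = Cmod w).
{ unfold b; rewrite Hgm by exact Ua; rewrite Hfa; unfold mobius.
  replace ((0 - w) * / (1 - Cconj w * 0))%C with (- w)%C; [apply Cmod_opp|].
  field; replace (1 - Cconj w * 0)%C with (RtoC 1) by ring; exact C1_nz. }
assert (Hpsi := C1_on_comp U unit_disc _ _ _ _ (C1_on_mobius b Hb) Hg Hgd).
eexists; eexists; split; [split; [exact Hpsi|split; [|split]]|].
- fold b; unfold mobius; ring.
- intros z Hz; apply mobius_unit_disc; [exact Hb|apply Hgd, Hz].
- intros z1 z2 H1 H2 E; apply Hfi; [exact H1|exact H2|].
  apply (mobius_injective w); [exact Hw|apply Hfd, H1|apply Hfd, H2|].
  apply mobius_injective in E; [|exact Hb|apply Hgd, H1|apply Hgd, H2].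
  rewrite <- (Hgg z1 H1), <- (Hgg z2 H2), E; reflexivity.
- cbv beta; fold b.
  assert (Hs := sqrt_derivative g g' _ _ a Hg Hphi Hgg Ua); fold b in Hs; cbv beta in Hs.
  assert (E1 : mobius' w (f a) = RtoC (1 - Cmod w ^ 2)).
  { rewrite Hfa; unfold mobius'; rewrite Cconj_mul_self, RtoC_minus.
    field; replace (1 - Cconj w * 0)%C with (RtoC 1) by ring; exact C1_nz. }
  assert (Db := disc_sqr_lt b Hb).
  assert (E2 : mobius' b b = RtoC (/ (1 - Cmod b ^ 2))).
  { unfold mobius'; rewrite Cconj_mul_self, RtoC_inv, RtoC_minus by lra.
    field; intros E; cbv beta in E; rewrite <- RtoC_minus in E; apply RtoC_inj in E; lra. }
  rewrite E1 in Hs; rewrite E2, Cmod_mult, Cmod_R.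
  apply (f_equal Cmod) in Hs; rewrite !Cmod_mult, !Cmod_R in Hs.
  rewrite (Rabs_pos_eq 2), (Rabs_pos_eq (1 - _)) in Hs by (try apply Rlt_le, disc_sqr_lt; try lra; exact Hw).
  rewrite Rabs_pos_eq by (apply Rlt_le, Rinv_0_lt_compat, Db).
  assert (Hp := proj1 (Cmod_gt_0 _) Hf'a).
  set (p := Cmod (f' a)) in *; set (q := Cmod (g' a)) in *.
  rewrite <- Hmw in Hs; unfold unit_disc in Hb.
  set (t := Cmod b) in *.
  assert (Ht : 0 <= t) by apply Cmod_ge_0.
  (* If t were 0, the relation [Hs] would read 0 = |f'(a)|. *)
  assert (Ht0 : 0 < t).
  { destruct Ht as [Ht|Ht]; [exact Ht|]; rewrite <- Ht in Hs; nra. }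
  apply (Rmult_lt_reg_r (1 - t ^ 2)); [exact Db|].
  rewrite Rmult_assoc, Rinv_l, Rmult_1_r by lra.
  apply (Rmult_lt_reg_l (2 * t)); [lra|]; rewrite Hs.
  replace (p * (1 - (t * t) ^ 2)) with (p * (1 - t ^ 2) * (1 + t ^ 2)) by ring.
  replace (2 * t * (p * (1 - t ^ 2))) with (p * (1 - t ^ 2) * (2 * t)) by ring.
  apply Rmult_lt_compat_l; [apply Rmult_lt_0_compat; assumption|nra].
Qed.

Lemma normalized_derivative_bound :
  exists M, forall f f', normalized f f' -> Cmod (f' a) <= M.
Proof.
destruct (U_open a Ua) as [r [Hr HrU]].
exists (1 / (r / 2)); intros f f' [Hf [_ [Hd _]]].
apply (cauchy_estimate f f' a r); [exact (C1_on_mono _ _ _ _ HrU Hf)|lra|].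
intros w Hw; apply Rlt_le, Hd, HrU, Hw.
Qed.

(** If |g| reached 1, or g took a value twice, Hurwitz's theorem would make a nonempty level set of
    g open, so g would be constant by connectedness, against g'(a) <> 0. *)
Lemma normalized_ultralimit (W : (nat -> Prop) -> Prop) (f f' : nat -> C -> C) (g g' : C -> C) :
  is_ultrafilter W -> (forall n, normalized (f n) (f' n)) ->
  (forall z, U z -> ulim W (fun n => f n z) (g z)) ->
  C1_on U g g' -> g' a <> 0 -> normalized g g'.
Proof.
intros HW Hf Hlim Hg Hg'a.
assert (HP := proj1 HW).
assert (Hga : g a = 0).
{ apply (ulim_unique W HW (fun n => f n a)); [apply Hlim, Ua|].
  intros eps He; apply filter_forall; intros n; rewrite (proj1 (proj2 (Hf n))).
  apply (Cball_center 0 eps He). }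
assert (Hgc : forall z, U z -> continuous (T := CU) (U := CU) g z).
{ intros z Hz; exact (Cder_cont _ _ _ (proj1 (Hg z Hz))). }
assert (Hnc : forall c, (forall z, U z -> g z = c) -> False).
{ intros c Hconst; apply Hg'a; destruct (U_open a Ua) as [r [Hr HrU]].
  apply (Cder_unique g a); [apply Hg, Ua|].
  apply (Cder_ext_ball (fun _ => c) g a _ r Hr); [|apply Cder_const].
  intros w Hw; symmetry; apply Hconst, HrU, Hw. }
assert (Hlt : forall n z, U z -> Cmod (f n z) < 1) by (intros n z Hz; apply (Hf n), Hz).
assert (H2 : RtoC 2 <> 0) by (intros E; apply RtoC_inj in E; lra).
(* The factor 1/2 brings differences of values in the closed disc under the bound 1 that
   [hurwitz_zero] asks for. *)
assert (Hhalf : forall u v : C, Cmod u <= 1 -> Cmod v <= 1 -> Cmod (/ 2 * (u - v)) <= 1).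
{ intros u v Hu Hv; rewrite Cmod_mult, Cmod_inv, Cmod_R, Rabs_pos_eq by (try exact H2; lra).
  generalize (Cmod_triangle u (- v)); rewrite Cmod_opp; unfold Cminus; lra. }
(* Hurwitz's theorem, with [u] constant for the bound [|g| < 1] and [u n = f n x] for injectivity. *)
assert (Loc : forall (u : nat -> C) (y : C) (r : R), 0 < r -> (forall z, Cball y r z -> U z) ->
  (forall n, Cmod (u n) <= 1) -> ulim W u (g y) ->
  (forall n z, Cball y r z -> f n z <> u n) ->
  exists s, 0 < s /\ forall z, Cball y s z -> g z = g y).
{ intros u y r Hr HrU Hu Hul Hne; exists (r / 4); split; [lra|]; intros z Hz.
  assert (Hz' : Cball y r z) by (unfold Cball in *; lra).
  assert (Hy := Cball_center y r Hr).
  assert (L : forall x, Cball y r x -> ulim W (fun n => / 2 * (f n x - u n))%C (/ 2 * (g x - g y))%C).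
  { intros x Hx; apply ulim_scal; [exact HW|]; apply ulim_minus; [exact HW|apply Hlim, HrU, Hx|exact Hul]. }
  assert (E : (/ 2 * (g z - g y))%C = 0).
  { apply (hurwitz_zero W HW y z r (fun n x => / 2 * (f n x - u n))%C
      (fun n x => 0 * (f n x - u n) + / 2 * (f' n x - 0))%C).
    - intros n; apply (C1_on_mult _ (fun _ => / 2)%C (fun _ => RtoC 0)); [apply C1_on_const|].
      apply (C1_on_minus _ (f n) (f' n) (fun _ => u n) (fun _ => RtoC 0)); [|apply C1_on_const].
      exact (C1_on_mono _ _ _ _ HrU (proj1 (Hf n))).
    - intros n x Hx; apply Cmult_neq_0.
      + intros E; apply C1_nz; transitivity (2 * / 2)%C; [field; exact H2|rewrite E; ring].
      + intros E; apply (Hne n x Hx), Ceq_minus, E.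
    - intros n x Hx; apply Hhalf; [apply Rlt_le, Hlt, HrU, Hx|apply Hu].
    - exact Hz.
    - generalize (L y Hy); replace (/ 2 * (g y - g y))%C with (RtoC 0) by ring; exact (fun h => h).
    - apply L, Hz'. }
  apply Ceq_minus; transitivity (2 * (/ 2 * (g z - g y)))%C; [field; exact H2|rewrite E; ring]. }
split; [exact Hg|split; [exact Hga|split]].
- intros z Hz; unfold unit_disc; apply Rnot_le_lt; intros Hle.
  assert (Hle1 : Cmod (g z) <= 1).
  { refine (ulim_le W HW _ _ 1 _ (Hlim z Hz)); apply filter_forall; intros n; apply Rlt_le, Hlt, Hz. }
  apply (Hnc (g z)); apply constant_of_open_level; [exact Hgc| |exists z; auto].
  intros y Hy E; destruct (U_open y Hy) as [r [Hr HrU]]; rewrite <- E.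
  apply (Loc (fun _ => g y) y r Hr HrU).
  + intros n; rewrite E; exact Hle1.
  + apply ulim_const, HW.
  + intros n x Hx E'; generalize (Hlt n x (HrU x Hx)); rewrite E', E; lra.
- intros z1 z2 H1 Hz2 E; apply NNPP; intros Hne12.
  apply (Hnc (g z1)); apply constant_of_open_level; [exact Hgc| |exists z1; auto].
  intros y Hy Ey; rewrite <- Ey.
  (* Every point y of the level set has a partner x with the same value: one of [z1] and [z2]
     differs from y. *)
  assert (Hx : exists x, U x /\ g x = g y /\ x <> y).
  { destruct (classic (y = z1)) as [->|Hy1].
    - exists z2; split; [exact Hz2|]; split; [auto|]; intros E'; apply Hne12; auto.
    - exists z1; split; [exact H1|]; split; auto. }
  destruct Hx as [x [HxU [Exy Hxy]]].
  assert (Hpos : 0 < Cmod (x - y)) by (apply Cmod_gt_0; intros E'; apply Hxy, Ceq_minus, E').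
  destruct (U_open y Hy) as [r [Hr HrU]].
  (* A disc of this radius about y excludes x, so by injectivity [f n] omits the value [f n x] on
     it. *)
  apply (Loc (fun n => f n x) y (Rmin r (Cmod (x - y)))).
  + apply Rmin_pos; assumption.
  + intros z Hz; apply HrU; eapply Rlt_le_trans; [exact Hz|apply Rmin_l].
  + intros n; apply Rlt_le, Hlt, HxU.
  + rewrite <- Exy; apply Hlim, HxU.
  + intros n z Hz E'.
    assert (HzU : U z) by (apply HrU; eapply Rlt_le_trans; [exact Hz|apply Rmin_l]).
    apply (proj2 (proj2 (proj2 (Hf n))) z x HzU HxU) in E'; subst z.
    apply (Rlt_irrefl (Cmod (x - y))); eapply Rlt_le_trans; [exact Hz|apply Rmin_r].
Qed.

(** Competitors with |f'(a)| > M - 1/(n + 1), where M is the supremum, have an ultralimit whose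
    derivative at a has modulus M. Since some competitor has nonzero derivative, M > 0, which is
    what lets the limit be a competitor. *)
Lemma extremal_exists :
  ~ (forall z, U z) ->
  exists f f', normalized f f' /\ f' a <> 0 /\
    forall g g', normalized g g' -> Cmod (g' a) <= Cmod (f' a).
Proof.
intros Hne.
destruct (normalized_exists Hne) as [f0 [f0' [Hf0 Hf0a]]].
destruct normalized_derivative_bound as [B HB].
destruct (completeness (fun x => exists f f', normalized f f' /\ x = Cmod (f' a))) as [M [HM1 HM2]].
{ exists B; intros x [f [f' [Hf ->]]]; exact (HB f f' Hf). }
{ exists (Cmod (f0' a)), f0, f0'; split; [exact Hf0|reflexivity]. }
assert (HM : forall f f', normalized f f' -> Cmod (f' a) <= M).
{ intros f f' Hf; apply HM1; exists f, f'; split; [exact Hf|reflexivity]. }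
assert (Hseq : forall n : nat, exists p : (C -> C) * (C -> C),
  normalized (fst p) (snd p) /\ M - / (INR n + 1) < Cmod (snd p a)).
{ intros n; apply NNPP; intros Hno.
  assert (Hp : 0 < / (INR n + 1)) by (apply Rinv_0_lt_compat; generalize (pos_INR n); lra).
  assert (M <= M - / (INR n + 1)); [|lra].
  apply HM2; intros x [f [f' [Hf ->]]]; apply Rnot_lt_le; intros Hlt.
  apply Hno; exists (f, f'); split; assumption. }
set (p := fun n => proj1_sig (constructive_indefinite_description _ (Hseq n))).
assert (Hp : forall n, normalized (fst (p n)) (snd (p n)) /\ M - / (INR n + 1) < Cmod (snd (p n) a)).
{ intros n; unfold p; destruct (constructive_indefinite_description _ (Hseq n)); assumption. }
destruct ultrafilter_exists as [W HW].
assert (HPF := proj1 HW).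
destruct (ultralimit_holomorphic W HW U (fun n => fst (p n)) (fun n => snd (p n)) U_open) as [g [g' Hg]].
{ intros n; apply (Hp n). }
{ intros n z Hz; apply Rlt_le; apply (Hp n), Hz. }
(* The ultralimit comes only with a pointwise derivative [g']; [g1] is a continuous one, equal to it
   at [a] by uniqueness. *)
destruct (holomorphic_C1 g) as [g1 Hg1].
{ intros z Hz; exists (g' z); apply Hg, Hz. }
assert (Eg : g1 a = g' a).
{ apply (Cder_unique g a); [apply Hg1, Ua|apply Hg, Ua]. }
assert (HMg : M <= Cmod (g1 a)).
{ rewrite Eg; apply le_epsilon; intros eps He.
  assert (He2 : 0 < eps / 2) by lra.
  (* Tails belong to [W], so some index n has both a small defect 1/(n + 1) and a derivative at [a]
     close to [g' a]. *)
  assert (Hev : W (fun n => / (INR n + 1) < eps / 2)).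
  { apply (proj2 (proj2 HW)).
    destruct (archimed_cor1 (eps / 2) He2) as [N [HN HN0]].
    exists N; intros n Hn; eapply Rle_lt_trans; [|exact HN].
    apply Rinv_le_contravar; [apply lt_0_INR; exact HN0|].
    apply le_INR in Hn; lra. }
  destruct (filter_ex _ (filter_and _ _ Hev (proj1 (proj2 (Hg a Ua)) (eps / 2) He2))) as [n [A Bn]].
  assert (Hn := proj2 (Hp n)).
  generalize (Cmod_triangle (snd (p n) a - g' a) (g' a)).
  replace (snd (p n) a - g' a + g' a)%C with (snd (p n) a) by ring; lra. }
assert (HMpos : 0 < M).
{ eapply Rlt_le_trans; [apply Cmod_gt_0, Hf0a|apply HM with (1 := Hf0)]. }
assert (Hg1a : g1 a <> 0) by (apply Cmod_gt_0; lra).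
exists g, g1; split; [|split; [exact Hg1a|]].
- apply (normalized_ultralimit W (fun n => fst (p n)) (fun n => snd (p n))); auto.
  + intros n; apply (Hp n).
  + intros z Hz; apply Hg, Hz.
- intros f f' Hf; generalize (HM f f' Hf); lra.
Qed.

Lemma riemann_map :
  ~ (forall z, U z) ->
  exists f : C -> C, holomorphic_on U f /\
    (forall z w, U z -> U w -> f z = f w -> z = w) /\
    (forall w, unit_disc w <-> exists z, U z /\ f z = w).
Proof.
intros Hne; destruct (extremal_exists Hne) as [f [f' [Hf [Hf'a Hmax]]]].
assert (Hf0 := Hf); destruct Hf0 as [HC [_ [Hd Hi]]].
exists f; split; [exact (C1_holomorphic f f' HC)|split; [exact Hi|]].
intros w; split; [|intros [z [Hz <-]]; apply Hd, Hz].
intros Hw; apply NNPP; intros Hno.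
destruct (normalized_improve f f' w Hf Hf'a Hw) as [g [g' [Hg Hlt]]].
{ intros z Hz E; apply Hno; exists z; split; assumption. }
generalize (Hmax g g' Hg); lra.
Qed.
End RiemannMapping.

(** * Openness and connectedness in terms of discs *)

Lemma open_Copen (D : C -> Prop) : open (T := C_UniformSpace) D <-> Copen D.
Proof.
split; intros H z Hz.
- destruct (proj1 (locally_C z D) (H z Hz)) as [r Hr].
  exists r; split; [apply cond_pos|]; intros w Hw; apply Hr; exact Hw.
- destruct (H z Hz) as [r [Hr HrD]].
  apply (proj2 (locally_C z D)); exists (mkposreal r Hr); intros w Hw; apply HrD; exact Hw.
Qed.

Lemma open_interior (P : C -> Prop) :
  open (T := C_UniformSpace) (fun z => exists r, 0 < r /\ forall w, Cball z r w -> P w).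
Proof.
apply open_Copen; intros z [r [Hr H]]; exists (r / 2); split; [lra|]; intros w Hw.
exists (r / 2); split; [lra|]; intros v Hv; apply H.
replace r with (r / 2 + r / 2) by field; exact (Cball_trans z w v _ _ Hw Hv).
Qed.

(** [P] need not be open in the plane, so the separating sets are the interiors of [P] and of its
    complement: they are open and disjoint, and they cover [U]. *)
Lemma connected_clopen (U P : C -> Prop) :
  connected (T := C_UniformSpace) U ->
  (forall z, U z -> P z -> exists r, 0 < r /\ forall w, Cball z r w -> P w) ->
  (forall z, U z -> ~ P z -> exists r, 0 < r /\ forall w, Cball z r w -> ~ P w) ->
  (exists z, U z /\ P z) -> forall z, U z -> P z.
Proof.
intros [_ Hc] H1 H2 [x [Hx HPx]] z Hz; apply NNPP; intros HPz.
destruct (Hc _ _ (open_interior P) (open_interior (fun z => ~ P z))) as [y [_ [[r [Hr Hy]] [s [Hs Hy']]]]].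
- intros y Hy; destruct (classic (P y)); [left|right]; auto.
- exists x; auto.
- exists z; auto.
- exact (Hy' y (Cball_center y s Hs) (Hy y (Cball_center y r Hr))).
Qed.

Theorem theorem1p1 (U : C -> Prop)
  (hopen : open U) (hconn : connected U) (hne : ~ (forall z : C, U z))
  (hsc : holomorphically_simply_connected U) :
  exists f : C -> C,
    holomorphic_on U f /\
    (forall z w : C, U z -> U w -> f z = f w -> z = w) /\
    (forall w : C, unit_disc w <-> exists z : C, U z /\ f z = w).
Proof.
destruct (proj1 hconn) as [a Ha].
refine (riemann_map U (proj1 (open_Copen U) hopen) _ _ a Ha hne).
- intros P; exact (connected_clopen U P hconn).
- intros f Hf; destruct (hsc f Hf) as [F [_ HF]]; exists F; exact HF.
Qed.
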